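(* Let $\{k_p\}_{p\ge1}$ be a strictly increasing sequence of positive integers, and for each $N$ let $\mathbf{X}=\mathbf{V}\mathbf{V}^*$ where $\mathbf{V}$ is the $N\times N$ generalized random Vandermonde matrix associated with $\{k_p\}$. Assume that for every $r\ge1$ and every partition $\rho\in\mathcal{P}(r)$ the limit $$K_\rho=\lim_{N\to\infty}\frac{|S_{\rho,N}|}{N^{r+1-|\rho|}}$$ exists. Then $0\le K_\rho\le1$ for all $\rho$, the limits $m_r=\lim_{N\to\infty}\mathbb{E}\big(\mathrm{tr}_N(\mathbf{X}^r)\big)$ exist for all $r\ge0$ and satisfy $$m_r=\sum_{\rho\in\mathcal{P}(r)}K_\rho\quad(r\ge1),$$ and there exists a unique probability measure $\mu$ supported on $[0,\infty)$ with $m_r=\int_0^\infty t^r\,d\mu(t)$ for all $r$.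
   Context: Generalized random Vandermonde matrix: with $\theta_1,\ldots,\theta_N$ i.i.d. uniform on $[0,1]$ and $z_q=e^{2\pi i\theta_q}$, $V(p,q)=\frac{1}{\sqrt N}z_q^{k_p}$ for $p,q=1,\ldots,N$ (the case $k_p=p-1$ is the usual Vandermonde matrix). $\mathrm{tr}_N=\frac1N\mathrm{Tr}$. $\mathcal{P}(r)$ is the set of partitions of $\{1,\ldots,r\}$, $|\rho|$ is the number of blocks of $\rho$. For $\rho$ with blocks $B_1,\ldots,B_{|\rho|}$, $$S_{\rho,N}=\Big\{(p_1,\ldots,p_r)\in\{1,\ldots,N\}^r:\ \sum_{i\in B_j}k_{p_i}=\sum_{i\in B_j}k_{p_{i+1}}\ \text{for all } j\Big\},$$ with the convention $p_{r+1}=p_1$. *)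

(* Defs.v *)
From HB Require Import structures.
From mathcomp Require Import all_boot all_order all_algebra.
From mathcomp Require Import all_classical all_reals all_analysis.
From mathcomp Require Import complex.
Set Implicit Arguments. Unset Strict Implicit. Unset Printing Implicit Defensive.
Import Order.TTheory GRing.Theory Num.Theory.
Import numFieldNormedType.Exports.
Local Open Scope classical_set_scope.
Local Open Scope ring_scope.

(* The sequence {k_p}_{p>=1} is encoded as k : nat -> nat, read at p >= 1
   (the value k 0 is irrelevant).  The index p : 'I_N stands for p.+1. *)

Definition S_set (k : nat -> nat) (r N : nat) (rho : {set {set 'I_r}}) :
    {set {ffun 'I_r -> 'I_N}} :=
  [set f : {ffun 'I_r -> 'I_N} | [forall B in rho,
     (\sum_(i in B) k (f i).+1 == \sum_(i in B) k (f (ordS i)).+1)%N]].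

Definition S_ratio (R : realType) (k : nat -> nat) (r : nat)
    (rho : {set {set 'I_r}}) (N : nat) : R :=
  (#|S_set k N rho|)%:R / (N%:R ^+ (r.+1 - #|rho|)).

Definition Klim (R : realType) (k : nat -> nat) (r : nat)
    (rho : {set {set 'I_r}}) : R :=
  limn (S_ratio R k rho).

Definition expi (R : realType) (theta : R) : R[i] :=
  Complex (cos (2 * pi * theta)) (sin (2 * pi * theta)).

Definition Vmx (R : realType) (k : nat -> nat) (N : nat) (th : nat -> R) :
    'M[R[i]]_N :=
  \matrix_(p, q) (real_complex R ((Num.sqrt (N%:R : R))^-1) * (expi (th q)) ^+ (k p.+1)) : 'M[R[i]]_N.

Definition Xmx (R : realType) (k : nat -> nat) (N : nat) (th : nat -> R) :
    'M[R[i]]_N :=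
  Vmx k N th *m (map_mx (@conjc R) (Vmx k N th))^T.

(* tr_N (X^r) (a real number since X is Hermitian; we take the real part). *)
Definition trX (R : realType) (k : nat -> nat) (N r : nat) (th : nat -> R) : R :=
  @complex.Re R ((N%:R)^-1 * \tr (Xmx k N th ^+ r)).

(* Expectation over theta_1..theta_n i.i.d. uniform on [0,1], written as the
   iterated Lebesgue integral over [0,1]^n (coordinates 0..n-1). *)
Fixpoint unif_expect (R : realType) (n : nat) (f : (nat -> R) -> R) : R :=
  match n with
  | 0 => f (fun _ => 0)
  | n'.+1 => Rintegral (@lebesgue_measure R) `[0, 1]
      (fun x => unif_expect n' (fun t => f (fun j => if j == n' then x else t j)))
  end.

Definition moment_seq (R : realType) (k : nat -> nat) (r N : nat) : R :=
  unif_expect N (trX k N r).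

(* Main.v *)
(** Expanding the trace, E tr_N(X^r) is N^(-r-1) times the number of pairs (p, q) of maps
    from {1..r} to {1..N} such that the exponent of every z_j vanishes, i.e. such that p
    solves the system attached to the kernel rho of q; there are N(N-1)..(N-|rho|+1) maps q
    with kernel rho.  A solution of the system of rho is determined by p_1 and by the p_i
    where i is not the least element of its block, whence |S_rho,N| <= N^(r+1-|rho|).

    The same count holds when the uniform law is replaced by a fine enough grid, so m_r is a
    limit of moments of finitely supported laws on [0, oo) (the mean spectral measures).  An
    ultrafilter limit of their tails, made right-continuous, is the tail of a law with moments
    m_r.  Finally m_r is at most the Bell number, which is at most the sum of N^r/N! over
    N <= r, so s^r m_r/r! tends to 0 for every s: the moments determine the Laplace transform,
    and the tails are limits of integrals of (1 - e^(-nt))^j with j = floor(n e^(nx)). *)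

Require Import Defs.
From HB Require Import structures.
From mathcomp Require Import all_boot all_order all_algebra.
From mathcomp Require Import all_classical all_reals all_analysis.
From mathcomp Require Import complex measurable_realfun.
From mathcomp Require Import zify ring lra.
Import Order.TTheory GRing.Theory Num.Theory.
Import numFieldNormedType.Exports.

Local Open Scope ring_scope.

Set Implicit Arguments.
Unset Strict Implicit.
Unset Printing Implicit Defensive.

(** * Counting maps by their kernel *)

Section Counting.
Import mathcomp.boot.finset.

(** Two solutions that agree on [D] are compared at the largest index where they differ. That index
    is the least of its block, so the block equation contains it once on the left and otherwise only
    positions where the solutions agree. *)
Lemma card_S_set_le (k : nat -> nat) (r N : nat) (rho : {set {set 'I_r}}) :
  (forall p q : nat, (0 < p)%N -> (p < q)%N -> (k p < k q)%N) ->
  (0 < r)%N -> partition rho [set: 'I_r] ->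
  (#|S_set k N rho| <= N ^ (r.+1 - #|rho|))%N.
Proof.
case: r rho => // n rho k_incr _ prho.
have k_inj (a b : 'I_N) : k a.+1 = k b.+1 -> a = b.
  move=> e; apply: val_inj; case: (ltngtP a b) => // h.
  - by have := @k_incr a.+1 b.+1 isT h; rewrite e ltnn.
  - by have := @k_incr b.+1 a.+1 isT h; rewrite e ltnn.
have /and3P[/eqP covrho trho rho0] := prho.
have covT i : i \in cover rho by rewrite covrho inE.
pose ismin (i : 'I_n.+1) := [forall j in pblock rho i, i <= j]%N.
pose M := [set i | ismin i].
(* Block minima other than index 0 are recovered from the equations; index 0, which stands for
   [p_1], stays free because [ordS] wraps round to it. *)
pose D := ~: (M :\ ord0).
have leM : (#|rho| <= #|M|)%N.
  suff sub : rho \subset pblock rho @: M.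
    exact: leq_trans (subset_leq_card sub) (leq_imset_card _ _).
  apply/fintype.subsetP => B BinR; apply/imsetP.
  have [i0 i0B] : exists i, i \in B.
    by apply/set0Pn; apply: contraNneq rho0 => <-.
  case: (arg_minnP (P := mem B) (fun i : 'I_n.+1 => i : nat) i0B) => i iB imin.
  have pB : pblock rho i = B by exact: def_pblock.
  exists i => //; rewrite inE /ismin pB; apply/forall_inP => j jB; exact: imin.
have cardD : (#|D| <= n.+2 - #|rho|)%N.
  have := cardsC (M :\ ord0); rewrite card_ord -/D.
  have := cardsD1 ord0 M; move: leM; lia.
pose res (f : {ffun 'I_n.+1 -> 'I_N}) : {ffun {i | i \in D} -> 'I_N} :=
  [ffun i => f (val i)].
have res_inj : {in S_set k N rho &, injective res}.
  move=> f g fS gS efg; apply/ffunP => i0; apply/eqP/negPn/negP => ne0.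
  have eD i : i \in D -> f i = g i.
    by move=> iD; have /ffunP/(_ (exist _ i iD)) := efg; rewrite !ffunE.
  case: (arg_maxnP (P := fun i => f i != g i) (fun i : 'I_n.+1 => i : nat) ne0).
  move=> i nei imax.
  have iM : i \in M :\ ord0.
    by apply/negPn/negP => h; case/negP: nei; rewrite eD // inE.
  have [ine0 imin] : i != ord0 /\ ismin i by move: iM; rewrite !inE => /andP.
  have BinR : pblock rho i \in rho by exact: pblock_mem.
  have iB : i \in pblock rho i by rewrite mem_pblock.
  have eB j : j \in pblock rho i -> j != i -> f j = g j.
    move=> jB ji; apply: eD; rewrite !inE negb_and; apply/orP; right.
    apply/negP => /forall_inP /(_ i); rewrite (def_pblock trho BinR jB).
    move=> /(_ iB) le1; have := forall_inP imin _ jB => le2.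
    by move/eqP: ji; apply; apply: val_inj => /=; apply/eqP; rewrite eqn_leq le1.
  (* For [j >= i] the successor of [j] lies beyond [i], the last disagreement, or is the cyclic
     return to index 0, which is in [D]. *)
  have eS j : j \in pblock rho i -> f (ordS j) = g (ordS j).
    move=> jB; apply/eqP/negPn/negP => ne.
    have leSi := imax _ ne; have leij := forall_inP imin _ jB.
    have [ltj|gej] := ltnP j.+1 n.+1.
      by move: leSi; rewrite /= modn_small // => h; have := leq_trans h leij; rewrite ltnn.
    have j0 : ordS j = ord0.
      apply: val_inj => /=; have -> : j.+1 = n.+1 by apply/eqP; rewrite eqn_leq gej (ltn_ord j).
      by rewrite modnn.
    by move: ne; rewrite j0 eD ?eqxx // !inE eqxx.
  move: fS gS; rewrite !inE => /forall_inP/(_ _ BinR)/eqP Ef.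
  move/forall_inP/(_ _ BinR)/eqP => Eg; case/negP: nei; apply/eqP; apply: k_inj.
  have ER : (\sum_(j in pblock rho i) k (f (ordS j)).+1 =
             \sum_(j in pblock rho i) k (g (ordS j)).+1)%N.
    by apply: eq_bigr => j jB; rewrite eS.
  move: Ef; rewrite ER -Eg (bigD1 i) //= [RHS](bigD1 i) //=.
  rewrite (eq_bigr (fun j => k (g j).+1)) => [/addIn //|j /andP[jB ji]].
  by rewrite eB.
rewrite -(card_in_imset res_inj) (leq_trans (max_card _)) // card_ffun card_ord.
(* Since [0 ^ 0 = 1], the case [N = 0] needs both exponents positive; both powers then vanish. *)
rewrite card_sig; have [->|Npos] := posnP N; last by rewrite leq_pexp2l.
have : ord0 \in D by rewrite !inE eqxx.
have rhole : (#|rho| <= n.+1)%N.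
  by rewrite (leq_trans leM) // (leq_trans (max_card _)) ?card_ord.
by move=> h0; rewrite !exp0n ?subn_gt0 //; apply/card_gt0P; exists ord0.
Qed.

Lemma ker_ffun_factor (r N : nat) (rho : {set {set 'I_r}}) (q : {ffun 'I_r -> 'I_N}) i j :
  preim_partition q [set: 'I_r] = rho ->
  (q i == q j) = (pblock rho i == pblock rho j).
Proof.
move=> <-; set P := preim_partition _ _.
have := preim_partitionP q [set: 'I_r]; rewrite -/P => pP.
have /and3P[/eqP covP tP _] := pP.
rewrite eq_pblock ?covP ?inE // /P pblock_equivalence_partition ?inE //.
by move=> x y z _ _ _; split=> // /eqP ->.
Qed.

(** A map with kernel [rho] is an injective colouring of the blocks, read through [blk]. *)
Lemma card_ker_ffun (r N : nat) (rho : {set {set 'I_r}}) :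
  partition rho [set: 'I_r] ->
  #|[set q : {ffun 'I_r -> 'I_N} | preim_partition q [set: 'I_r] == rho]| =
  (N ^_ #|rho|)%N.
Proof.
move=> prho; have /and3P[/eqP covrho trho rho0] := prho.
have covT i : i \in cover rho by rewrite covrho inE.
have bP i : pblock rho i \in rho by exact: pblock_mem.
pose T := {B : {set 'I_r} | B \in rho}.
pose blk i : T := exist _ (pblock rho i) (bP i).
have cT : #|{: T}| = #|rho| by rewrite card_sig; apply: eq_card.
have := card_inj_ffuns T 'I_N; rewrite cT card_ord => <-.
pose h (g : {ffun T -> 'I_N}) : {ffun 'I_r -> 'I_N} := [ffun i => g (blk i)].
have blk_surj B : exists i, blk i = B.
  case: B => B BinR; have [i iB] : exists i, i \in B.
    by apply/set0Pn; apply: contraNneq rho0 => <-.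
  by exists i; apply: val_inj => /=; exact: def_pblock.
have h_inj : injective h.
  move=> g1 g2 e; apply/ffunP => B; have [i <-] := blk_surj B.
  by have /ffunP/(_ i) := e; rewrite !ffunE.
rewrite -(card_imset _ h_inj); apply: eq_card => q; rewrite inE.
apply/eqP/imsetP => [ek|[g]].
- have [i0 i0P] := boolp.choice blk_surj.
  exists [ffun B => q (i0 B)].
    rewrite inE; apply/injectiveP => B1 B2; rewrite !ffunE => /eqP.
    rewrite (ker_ffun_factor _ _ ek) => /eqP e.
    by rewrite -(i0P B1) -(i0P B2); apply: val_inj.
  apply/ffunP => i; rewrite !ffunE; apply/eqP; rewrite (ker_ffun_factor _ _ ek).
  by apply/eqP; have := congr1 val (i0P (blk i)).
- rewrite inE => /injectiveP ginj ->; rewrite -[RHS](preim_partition_pblock prho).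
  rewrite /preim_partition /equivalence_partition.
  apply: eq_imset => x; apply/setP => y; rewrite !inE !ffunE /=.
  apply/eqP/eqP => [/ginj/(congr1 val) //|e].
  by congr (g _); exact: val_inj.
Qed.

(** Serves twice: with solution counts as [F] to expand the moments, and with [F = 1] to bound the
    Bell numbers. *)
Lemma sum_ffun_ker (V : nmodType) (r N : nat) (F : {set {set 'I_r}} -> V) :
  \sum_(q : {ffun 'I_r -> 'I_N}) F (preim_partition q [set: 'I_r]) =
  \sum_(rho | partition rho [set: 'I_r]) F rho *+ (N ^_ #|rho|)%N.
Proof.
rewrite (partition_big (fun q : {ffun 'I_r -> 'I_N} => preim_partition q [set: 'I_r])
  (fun rho => partition rho [set: 'I_r])) /= => [|q _]; last exact: preim_partitionP.
apply: eq_bigr => rho prho.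
rewrite (eq_bigr (fun=> F rho)) => [|q /eqP -> //].
by rewrite sumr_const -(card_ker_ffun N prho); congr (_ *+ _); apply: eq_card => q; rewrite inE.
Qed.

Lemma card_partition_le (r : nat) (rho : {set {set 'I_r}}) :
  partition rho [set: 'I_r] -> (#|rho| <= r)%N.
Proof.
move=> prho; have /and3P[_ _ rho0] := prho.
rewrite -[leqRHS](card_ord r) -cardsT (card_partition prho) -sum1_card leq_sum // => B BinR.
by rewrite card_gt0; apply: contraNneq rho0 => <-.
Qed.

End Counting.

(** * Expectation of trigonometric polynomials *)

Section Expectation.
Context {R : realType}.
Implicit Types (x phi : R) (c : int) (M n : nat).

Lemma sin_cosD2piz x c :
  sin (x + 2 * pi * c%:~R) = sin x /\ cos (x + 2 * pi * c%:~R) = cos x.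
Proof.
have S (f : R -> R) (fp : periodic f (pi *+ 2)) n y : f (y + 2 * pi * n%:R) = f y.
  by rewrite -(periodicn fp n y) -[pi *+ 2]mulr_natl mulr_natr.
suff S' (f : R -> R) (fp : periodic f (pi *+ 2)) y : f (y + 2 * pi * c%:~R) = f y.
  by split; apply: S'; [exact: sinD2pi | exact: cosD2pi].
case: c => m; first exact: S.
by rewrite NegzE mulrNz mulrN; have := S f fp m.+1 (y - 2 * pi * m.+1%:R); rewrite subrK => ->.
Qed.

(** The free phase [phi] carries the contribution of the other variables when integrals are
    iterated. For a nonzero integer [c] the primitive has period 1. *)
Lemma Rintegral_cos phi c :
  Rintegral (@lebesgue_measure R) `[0, 1]%classic
    (fun x => cos (phi + 2 * pi * c%:~R * x)) = cos phi *+ (c == 0).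
Proof.
have [->|c0] := eqVneq c 0.
  under eq_Rintegral do rewrite mulr0 mul0r addr0.
  by rewrite Rintegral_cst //= lebesgue_measure_itv /= lte_fin ltr01 oppr0 adde0 mulr1.
pose k := 2 * pi * (c%:~R : R).
have k0 : k != 0.
  by rewrite !mulf_neq0 ?intr_eq0 // ?gt_eqF ?pi_gt0.
have dlin x : is_derive x 1 (fun x => phi + k * x) k.
  by apply: is_derive_eq; rewrite add0r mul1r /GRing.scale /= mulr1.
have dsin x : is_derive x 1 (fun x => k^-1 * sin (phi + k * x)) (cos (phi + k * x)).
  have h : is_derive x 1 (sin \o (fun x => phi + k * x)) (cos (phi + k * x) * k).
    exact: is_derive1_comp.
  have := is_deriveZ (k^-1) h; rewrite [_ *: (_ * k)]mulrC mulfK //.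
have dcos x : derivable (fun x => cos (phi + k * x)) x 1.
  have h : is_derive x 1 (cos \o (fun x => phi + k * x)) (- sin (phi + k * x) * k).
    exact: is_derive1_comp.
  exact: ex_derive.
have cts (f : R -> R) : (forall x, derivable f x 1) -> continuous f.
  by move=> df x; apply: differentiable_continuous; apply/derivable1_diffP.
rewrite /Rintegral (@continuous_FTC2 _ _ (fun x => k^-1 * sin (phi + k * x))) //.
- rewrite -EFinB /= mulr1 mulr0 addr0.
  by rewrite (sin_cosD2piz phi c).1 subrr.
- by apply: continuous_subspaceT; exact: cts.
- split; first by move=> x _; exact: ex_derive.
  + apply: cvg_at_right_filter.
    by apply: (cts (fun x => k^-1 * sin (phi + k * x))) => x; exact: ex_derive.
  + apply: cvg_at_left_filter.
    by apply: (cts (fun x => k^-1 * sin (phi + k * x))) => x; exact: ex_derive.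
- by move=> x _; rewrite derive1E derive_val.
Qed.

Lemma Rintegral_sum_cos (I : finType) (w phi : I -> R) (c : I -> int) :
  Rintegral (@lebesgue_measure R) `[0, 1]%classic
    (fun x => \sum_a w a * cos (phi a + 2 * pi * (c a)%:~R * x)) =
  \sum_a w a * (cos (phi a) *+ (c a == 0)).
Proof.
have ccont a : continuous (fun x : R => w a * cos (phi a + 2 * pi * (c a)%:~R * x)).
  move=> x; apply: cvgM; first exact: cvg_cst.
  apply: continuous_comp; last exact: continuous_cos.
  by apply: cvgD; [exact: cvg_cst | apply: cvgM; [exact: cvg_cst | exact: cvg_id]].
have cint (f : R -> R) : continuous f ->
    (@lebesgue_measure R).-integrable `[0, 1]%classic (EFin \o f).
  move=> cf; apply: continuous_compact_integrable; first exact: segment_compact.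
  exact: continuous_subspaceT.
elim: (index_enum I) => [|a s IH].
  rewrite big_nil; under eq_Rintegral do rewrite big_nil.
  by rewrite Rintegral_cst //= mul0r.
rewrite big_cons -IH; under eq_Rintegral do rewrite big_cons.
rewrite RintegralD //; last 2 first.
- exact: cint.
- apply: cint => x; elim: s {IH} => [|b s IH].
    by under eq_fun do rewrite big_nil; exact: cvg_cst.
  by under eq_fun do rewrite big_cons; apply: cvgD => //; exact: ccont.
congr (_ + _); rewrite RintegralZl ?Rintegral_cos //; apply: cint => x.
apply: continuous_comp; last exact: continuous_cos.
by apply: cvgD; [exact: cvg_cst | apply: cvgM; [exact: cvg_cst | exact: cvg_id]].
Qed.

Definition grid_mean M (f : R -> R) : R := M%:R^-1 * \sum_(m < M) f (m%:R / M%:R).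

(** Multiplying by [2 * sin u] with [u = pi * c / M] turns the sum of cosines into a telescoping sum
    of sines over whole periods. For [c != 0] the bound [|c| < M] puts [|u|] strictly between 0 and
    [pi], whence [sin u != 0]. *)
Lemma grid_mean_cos M phi c : (`|c| < M)%N ->
  grid_mean M (fun x => cos (phi + 2 * pi * c%:~R * x)) = cos phi *+ (c == 0).
Proof.
move=> cM; have M0 : (0 < M)%N by exact: leq_ltn_trans cM.
have MR0 : (M%:R : R) != 0 by rewrite pnatr_eq0 -lt0n.
rewrite /grid_mean; have [->|c0] := eqVneq c 0.
  under eq_bigr do rewrite mulr0 mul0r addr0.
  by rewrite sumr_const card_ord -[X in _ * X]mulr_natl mulrA mulVf // mul1r.
pose u := pi * (c%:~R : R) / M%:R.
have su : sin u != 0.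
  suff : sin `|u| != 0 by case: (ger0P u) => // _; rewrite sinN oppr_eq0.
  rewrite gt_eqF // sin_gt0_pi // normr_gt0 !mulf_neq0 ?intr_eq0 ?invr_eq0 //= ?gt_eqF ?pi_gt0 //.
  rewrite /u !normrM (gtr0_norm (pi_gt0 R)) normfV normr_nat -intr_norm.
  rewrite ltr_pdivrMr ?ltr0n // ltr_pM2l ?pi_gt0 //.
  by rewrite -abszE -[X in _ < X]/((M%:Z)%:~R) ltr_int ltz_nat.
have tel m : sin u * (2 * cos (phi + 2 * pi * c%:~R * (m%:R / M%:R))) =
    sin (phi - u + 2 * u * m.+1%:R) - sin (phi - u + 2 * u * m%:R).
  set y := phi + _.
  have -> : phi - u + 2 * u * m.+1%:R = y + u by rewrite /y /u -addn1 natrD; field.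
  have -> : phi - u + 2 * u * m%:R = y - u by rewrite /y /u; field.
  by rewrite sinD sinB; ring.
suff -> : \sum_(m < M) cos (phi + 2 * pi * c%:~R * (m%:R / M%:R)) = 0 by rewrite mulr0.
apply/eqP; have : sin u * (2 * \sum_(m < M) cos (phi + 2 * pi * c%:~R * (m%:R / M%:R))) == 0.
  rewrite !mulr_sumr; under eq_bigr => m _ do rewrite tel.
  rewrite -(big_mkord xpredT
    (fun m => sin (phi - u + 2 * u * m.+1%:R) - sin (phi - u + 2 * u * m%:R))).
  rewrite telescope_sumr // mulr0 addr0.
  have -> : 2 * u * M%:R = 2 * pi * c%:~R by rewrite /u; field.
  by rewrite (sin_cosD2piz (phi - u) c).1 subrr.
by rewrite !mulf_eq0 (negPf su) pnatr_eq0.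
Qed.

Lemma grid_mean_sum_cos M (I : finType) (w phi : I -> R) (c : I -> int) :
  (forall a, `|c a| < M)%N ->
  grid_mean M (fun x => \sum_a w a * cos (phi a + 2 * pi * (c a)%:~R * x)) =
  \sum_a w a * (cos (phi a) *+ (c a == 0)).
Proof.
move=> cM; rewrite /grid_mean exchange_big /= mulr_sumr; apply: eq_bigr => a _.
by rewrite -mulr_sumr mulrCA -(grid_mean_cos (phi a) (cM a)).
Qed.

(** Abstracting the one-variable mean lets the Lebesgue integral and the grid mean share one trace
    computation. *)
Fixpoint iter_expect (E : (R -> R) -> R) n (f : (nat -> R) -> R) : R :=
  match n with
  | 0 => f (fun _ => 0)
  | n'.+1 => E (fun x => iter_expect E n' (fun t => f (fun j => if j == n' then x else t j)))
  end.

Lemma unif_expectE n f :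
  unif_expect n f = iter_expect (Rintegral (@lebesgue_measure R) `[0, 1]%classic) n f.
Proof.
elim: n f => //= n IH f; congr (Rintegral _ _ _); apply/funext => x; exact: IH.
Qed.

(** [good] selects the frequencies on which [E] is known to be orthogonal: all of them for the
    Lebesgue integral, those below the grid size for the grid mean. *)
Lemma iter_expect_cos (E : (R -> R) -> R) (good : int -> bool) :
  (forall (I : finType) (w phi : I -> R) (c : I -> int), (forall a, good (c a)) ->
    E (fun x => \sum_a w a * cos (phi a + 2 * pi * (c a)%:~R * x)) =
    \sum_a w a * (cos (phi a) *+ (c a == 0))) ->
  forall n (I : finType) (w phi : I -> R) (c : I -> nat -> int),
  (forall a j, good (c a j)) ->
  iter_expect E n
    (fun t => \sum_a w a * cos (phi a + 2 * pi * \sum_(j < n) (c a j)%:~R * t j)) =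
  \sum_a w a * (cos (phi a) *+ [forall j : 'I_n, c a j == 0]).
Proof.
move=> hE; elim=> [|n IH] I w phi c cg /=.
  apply: eq_bigr => a _; rewrite big_ord0 mulr0 addr0.
  by rewrite (_ : [forall j, _] = true) //; apply/forallP => -[].
(* The outermost variable [x] moves into the phase, and the induction hypothesis handles the [n]
   inner ones. *)
transitivity (E (fun x => \sum_a (w a *+ [forall j : 'I_n, c a j == 0]) *
    cos (phi a + 2 * pi * (c a n)%:~R * x))).
  congr E; apply/funext => x.
  transitivity (iter_expect E n (fun t =>
      \sum_a w a * cos ((phi a + 2 * pi * (c a n)%:~R * x) +
                        2 * pi * \sum_(j < n) (c a j)%:~R * t j))).
    congr iter_expect; apply/funext => t; apply: eq_bigr => a _; congr (_ * cos _).
    rewrite big_ord_recr /= eqxx (eq_bigr (fun j : 'I_n => (c a j)%:~R * t j)); last first.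
      by move=> j _; rewrite ltn_eqF.
    by ring.
  by rewrite IH //; apply: eq_bigr => a _; rewrite [LHS]mulrnAr [RHS]mulrnAl.
rewrite hE //; apply: eq_bigr => a _; rewrite [LHS]mulrnAl -mulrnAr -mulrnA; congr (_ * (_ *+ _)).
rewrite mulnb; congr (nat_of_bool _); apply/andP/forallP => [[cn /forallP cj] j|cj].
  have [jn|nj] := ltnP j n; first exact: (cj (Ordinal jn)).
  by rewrite (_ : nat_of_ord j = n) //; apply/eqP; rewrite eqn_leq nj -ltnS ltn_ord.
by split; [exact: (cj ord_max) | apply/forallP => j; exact: (cj (widen_ord (leqnSn n) j))].
Qed.

End Expectation.

(** * Expansion of the trace of powers *)

Section TraceExpansion.
Context {R : realType}.
Implicit Types (k : nat -> nat) (r N : nat).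

Lemma big_cons_tuple (V : nmodType) (T : finType) n (F : n.+1.-tuple T -> V) :
  \sum_(t : n.+1.-tuple T) F t = \sum_(x : T) \sum_(s : n.-tuple T) F (cons_tuple x s).
Proof.
rewrite pair_bigA /= (reindex (fun p : T * n.-tuple T => cons_tuple p.1 p.2)) //=.
exists (fun t => (thead t, [tuple of behead t])) => [[x s] _|t _] /=.
  by congr (_, _); apply: val_inj.
by rewrite [RHS]tuple_eta; apply: val_inj.
Qed.

(** [s] lists the interior vertices of a path from [a] to [b]; at [i = n] the default value of
    [nth b s] provides the end [b]. *)
Lemma mxpowE (C : comPzRingType) N (A : 'M[C]_N) n a b :
  (A ^+ n.+1) a b =
  \sum_(s : n.-tuple 'I_N) \prod_(i < n.+1) A (nth b (a :: s) i) (nth b s i).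
Proof.
elim: n a => [|n IH] a.
  rewrite expr1 (big_pred1 [tuple]) => [|s]; last by rewrite [s]tuple0 /= eqxx.
  by rewrite big_ord1.
rewrite exprS mxE big_cons_tuple; apply: eq_bigr => c _.
rewrite IH mulr_sumr; apply: eq_bigr => s _.
by rewrite [RHS]big_ord_recl.
Qed.

Lemma mxtrace_pow (C : comPzRingType) N (A : 'M[C]_N) r : (0 < r)%N ->
  \tr (A ^+ r) = \sum_(p : {ffun 'I_r -> 'I_N}) \prod_i A (p i) (p (ordS i)).
Proof.
case: r => // n _; rewrite /mxtrace.
transitivity (\sum_(t : n.+1.-tuple 'I_N) \prod_i A (tnth t i) (tnth t (ordS i))).
  rewrite big_cons_tuple; apply: eq_bigr => a _; rewrite mxpowE.
  apply: eq_bigr => s _; apply: eq_bigr => i _; rewrite !(tnth_nth a) /=.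
  congr (A _ _); have [ltin|] := ltnP i n.
    by rewrite modn_small.
  move=> lein; have -> : nat_of_ord i = n by apply/eqP; rewrite eqn_leq lein -ltnS ltn_ord.
  by rewrite modnn nth_default ?size_tuple.
rewrite (reindex (@tuple_of_finfun 'I_N n.+1)) /=; last first.
  exists (@finfun_of_tuple 'I_N n.+1) => ? _; first exact: tuple_of_finfunK.
  exact: finfun_of_tupleK.
apply: eq_bigr => p _; apply: eq_bigr => i _.
by rewrite !tnth_map !tnth_ord_tuple.
Qed.

Lemma expiD (x y : R) : expi (x + y) = expi x * expi y.
Proof.
rewrite /expi mulrDr cosD sinD /=; apply/eqP; rewrite eq_complex /=.
by rewrite [X in _ && (_ == X)]addrC !eqxx.
Qed.

Lemma expi0 : expi (0 : R) = 1.
Proof. by rewrite /expi mulr0 cos0 sin0. Qed.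

Lemma expiX (x : R) n : expi x ^+ n = expi (n%:R * x).
Proof.
elim: n => [|n IH]; first by rewrite mul0r expi0.
by rewrite exprS IH -expiD -natr1 mulrDl mul1r addrC.
Qed.

Lemma conjc_expi (x : R) : conjc (expi x) = expi (- x).
Proof. by rewrite /expi /conjc mulrN cosN sinN. Qed.

Lemma prod_expi (I : finType) (f : I -> R) : \prod_i expi (f i) = expi (\sum_i f i).
Proof. by rewrite (big_morph _ expiD expi0). Qed.

(* Exponent of [z_j] in the term of [\tr (X ^+ r)] indexed by rows [p] and columns [q]. *)
Definition trX_freq k r N (pq : {ffun 'I_r -> 'I_N} * {ffun 'I_r -> 'I_N}) (j : nat) : int :=
  \sum_(i < r | pq.2 i == j :> nat)
    ((k (pq.1 i).+1)%:Z - (k (pq.1 (ordS i)).+1)%:Z).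

(** Each term of the expanded trace is a unit complex number whose phase is linear in the angles, so
    its real part is a cosine. The summand 0 gives the phase the shape expected by
    [iter_expect_cos]. *)
Lemma trX_sum_cos k r N (th : nat -> R) : (0 < r)%N ->
  trX k N r th = \sum_(pq : {ffun 'I_r -> 'I_N} * {ffun 'I_r -> 'I_N})
    N%:R ^- r.+1 * cos (0 + 2 * pi * \sum_(j < N) (trX_freq k pq j)%:~R * th j).
Proof.
move=> r0; rewrite /trX mxtrace_pow //.
have sq : real_complex R (Num.sqrt (N%:R : R))^-1 * real_complex R (Num.sqrt (N%:R : R))^-1
    = real_complex R (N%:R^-1).
  by rewrite -rmorphM -invfM -expr2 sqr_sqrtr.
have conjE (s x : R) n :
    conjc (real_complex R s * expi x ^+ n) = real_complex R s * expi (- x) ^+ n.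
  by rewrite rmorphM rmorphXn; congr (_ * _ ^+ _); [exact: conjc_real | exact: conjc_expi].
have X1 a b : Xmx k N th a b = real_complex R (N%:R^-1) *
    \sum_(q < N) expi (((k a.+1)%:R - (k b.+1)%:R) * th q).
  rewrite mxE mulr_sumr; apply: eq_bigr => q _; rewrite !mxE.
  rewrite conjE.
  by rewrite mulrACA !expiX -expiD sq mulrBl mulrN.
pose term (pq : {ffun 'I_r -> 'I_N} * {ffun 'I_r -> 'I_N}) : R :=
  \sum_(j < N) (trX_freq k pq j)%:~R * th j.
have X2 (p : {ffun 'I_r -> 'I_N}) : \prod_i Xmx k N th (p i) (p (ordS i)) =
    real_complex R (N%:R ^- r) * \sum_(q : {ffun 'I_r -> 'I_N}) expi (term (p, q)).
  under eq_bigr do rewrite X1.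
  rewrite big_split /= prodr_const card_ord -rmorphXn exprVn; congr (_ * _).
  rewrite bigA_distr_bigA; apply: eq_bigr => q _; rewrite prod_expi; congr expi.
  (* Grouping the indices [i] by the column [q i] collects the total exponent of each angle. *)
  rewrite /term /trX_freq /= (partition_big q xpredT) //=.
  apply: eq_bigr => j _; rewrite rmorph_sum mulr_suml.
  by apply: eq_big => [i|i /eqP <-]; rewrite ?rmorphB.
under eq_bigr do rewrite X2.
rewrite -mulr_sumr pair_bigA /= mulrA.
have -> : (N%:R : R[i])^-1 * real_complex R (N%:R ^- r) = real_complex R (N%:R ^- r.+1).
  by rewrite -(rmorph_nat (real_complex R)) -fmorphV -rmorphM exprS invfM.
rewrite mulr_sumr.
have ReD : {morph @complex.Re R : x y / x + y} by case=> ? ? [].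
rewrite (big_morph _ ReD (erefl : complex.Re (0 : R[i]) = 0)).
by apply: eq_bigr => -[p q] _; rewrite add0r /= mul0r subr0.
Qed.

Lemma trX0 k N (th : nat -> R) : (0 < N)%N -> trX k N 0 th = 1.
Proof.
move=> N0; rewrite /trX expr0.
have -> : (1 : 'M[R[i]]_N) = 1%:M by [].
by rewrite mxtrace1 mulVf ?pnatr_eq0 -?lt0n.
Qed.

(** The frequency of [j] is the defect in the equation of the fibre of [q] above [j]. The nonempty
    fibres are the blocks of the kernel; a column outside the image of [q] has an empty sum. *)
Lemma trX_freq_ker k r N (p q : {ffun 'I_r -> 'I_N}) :
  [forall j : 'I_N, trX_freq k (p, q) j == 0] =
  (p \in S_set k N (preim_partition q [set: 'I_r])).
Proof.
have E (P : pred 'I_r) : (\sum_(i | P i) ((k (p i).+1)%:Z - (k (p (ordS i)).+1)%:Z) == 0) =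
    (\sum_(i | P i) k (p i).+1 == \sum_(i | P i) k (p (ordS i)).+1)%N.
  by rewrite sumrB subr_eq0 -!(big_morph Posz PoszD erefl) eqz_nat.
have kerE (i i' : 'I_r) : (i' \in [set y in [set: 'I_r] | q i == q y]) = (q i' == q i).
  by rewrite !inE eq_sym.
rewrite inE; apply/forallP/forall_inP => [h B /imsetP[i _ ->]|h j].
  rewrite !(eq_bigl _ _ (kerE i)) -E.
  have := h (q i); rewrite /trX_freq /=; exact.
have [[i /eqP qi]|no] := pselect (exists i, q i == j).
  have /h : [set y in [set: 'I_r] | q i == q y] \in preim_partition q [set: 'I_r].
    by apply/imsetP; exists i.
  by rewrite !(eq_bigl _ _ (kerE i)) -E qi.
rewrite /trX_freq big_pred0 // => i; apply/negP => qi; apply: no; exists i; exact: qi.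
Qed.

(** Tells how fine a grid must be to integrate [trX k N r] exactly. *)
Lemma trX_freq_bound k r N (p q : {ffun 'I_r -> 'I_N}) j :
  (forall a b : nat, (0 < a)%N -> (a < b)%N -> (k a < k b)%N) ->
  (`|trX_freq k (p, q) j| <= r * k N)%N.
Proof.
move=> k_incr.
have kle (a : 'I_N) : (k a.+1 <= k N)%N.
  have [->//|/eqP ne] := a.+1 =P N.
  by apply/ltnW/k_incr => //; rewrite ltn_neqAle ne ltn_ord.
rewrite -lez_nat abszE /trX_freq (le_trans (ler_norm_sum _ _ _)) //.
rewrite (@le_trans _ _ (\sum_(i < r) (k N)%:Z)) //; last first.
  by rewrite sumr_const card_ord -mulr_natl natz -PoszM.
rewrite big_mkcond ler_sum // => i _; case: ifP => // _.
by have := kle (p i); have := kle (p (ordS i)); simpl; lia.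
Qed.

(** Only pairs [(p, q)] with all frequencies zero survive; for fixed [q], such [p] are the solutions
    attached to the kernel of [q]. *)
Lemma iter_expect_trX (E : (R -> R) -> R) (good : int -> bool) k r N :
  (forall (I : finType) (w phi : I -> R) (c : I -> int), (forall a, good (c a)) ->
    E (fun x => \sum_a w a * cos (phi a + 2 * pi * (c a)%:~R * x)) =
    \sum_a w a * (cos (phi a) *+ (c a == 0))) ->
  (forall (p q : {ffun 'I_r -> 'I_N}) j, good (trX_freq k (p, q) j)) -> (0 < r)%N ->
  iter_expect E N (trX k N r) =
  N%:R ^- r.+1 * \sum_(rho : {set {set 'I_r}} | finset.partition rho [set: 'I_r])
    (N ^_ #|rho| * #|S_set k N rho|)%:R.
Proof.
move=> hE hg r0.
have -> : trX k N r = (fun t : nat -> R => \sum_(pq : {ffun 'I_r -> 'I_N} * {ffun 'I_r -> 'I_N})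
    N%:R ^- r.+1 * cos (0 + 2 * pi * \sum_(j < N) (trX_freq k pq j)%:~R * t j)).
  by apply: boolp.funext => t; exact: trX_sum_cos.
rewrite (iter_expect_cos hE); last by case.
rewrite -mulr_sumr; congr (_ * _).
rewrite (eq_bigr (fun pq : {ffun 'I_r -> 'I_N} * {ffun 'I_r -> 'I_N} =>
  1 *+ (pq.1 \in S_set k N (preim_partition pq.2 [set: 'I_r]))));
  last by move=> -[p q] _; rewrite cos0 trX_freq_ker.
rewrite -(pair_bigA _ (fun p q : {ffun 'I_r -> 'I_N} =>
  1 *+ (p \in S_set k N (preim_partition q [set: 'I_r])))) /=.
rewrite exchange_big /=.
rewrite (eq_bigr (fun q : {ffun 'I_r -> 'I_N} =>
  (#|S_set k N (preim_partition q [set: 'I_r])|)%:R)); last first.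
  move=> q _; rewrite -sum1_card natr_sum [RHS]big_mkcond /=.
  by apply: eq_bigr => p _; case: ifP.
rewrite (sum_ffun_ker N (fun rho => (#|S_set k N rho|)%:R : R)).
by apply: eq_bigr => rho _; rewrite -mulrnA mulnC.
Qed.

End TraceExpansion.

(** * Limits of the moments and size of the Bell numbers *)

Section MomentLimit.
Context {R : realType}.
Implicit Types (k : nat -> nat) (r N : nat).
Local Open Scope classical_set_scope.

Lemma cvg_sumr (T : Type) (F : set_system T) (I : Type) (s : seq I) (P : pred I)
    (f : I -> T -> R) (l : I -> R) : Filter F ->
  (forall i, P i -> f i @ F --> l i) ->
  (fun x => \sum_(i <- s | P i) f i x) @ F --> \sum_(i <- s | P i) l i.
Proof. by move=> FF fl; apply: cvg_big => //; exact: add_continuous. Qed.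

Lemma cvg_natrV : (fun n : nat => (n%:R : R)^-1) @ \oo --> (0 : R).
Proof.
rewrite -(cvg_shiftn 1) /=.
under eq_fun do rewrite addn1.
exact: cvg_harmonic.
Qed.

Lemma cvg_ffact_ratio m : (fun n : nat => (n ^_ m)%:R / n%:R ^+ m : R) @ \oo --> (1 : R).
Proof.
elim: m => [|m IH].
  under eq_fun do rewrite ffactn0 expr0 divr1.
  exact: cvg_cst.
have h : (fun n : nat => (1 : R) - m%:R * (n%:R)^-1) @ \oo --> (1 : R).
  rewrite -[X in _ --> X]subr0 -[X in _ - X](mulr0 m%:R).
  by apply: cvgB; [exact: cvg_cst | apply: cvgM; [exact: cvg_cst | exact: cvg_natrV]].
rewrite -[X in _ --> X]mulr1; apply: cvg_trans (cvgM IH h); apply: near_eq_cvg.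
near=> n; have n0 : (0 < n)%N by near: n; exact: nbhs_infty_gt.
have mn : (m <= n)%N by near: n; exact: nbhs_infty_ge.
have nR0 : (n%:R : R) != 0 by rewrite pnatr_eq0 -lt0n.
rewrite ffactnSr natrM natrB // exprSr; move: nR0; set x : R := n%:R => x0.
have xm : x ^+ m != 0 by rewrite expf_neq0.
by rewrite /=; field; rewrite x0 xm.
Unshelve. all: by end_near. Qed.

Lemma S_ratio_ge0 k r (rho : {set {set 'I_r}}) N : 0 <= S_ratio R k rho N.
Proof. by rewrite divr_ge0 // exprn_ge0. Qed.

Lemma S_ratio_le1 k r (rho : {set {set 'I_r}}) N :
  (forall p q : nat, (0 < p)%N -> (p < q)%N -> (k p < k q)%N) ->
  (0 < r)%N -> finset.partition rho [set: 'I_r] -> S_ratio R k rho N <= 1.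
Proof.
move=> k_incr r0 prho; have := card_S_set_le N k_incr r0 prho; rewrite /S_ratio.
(* For [N = 0] the denominator is 0 to a positive power, and the ratio is 0 since the inverse of 0
   is 0. *)
have [->|N0] := posnP N.
  have rle := card_partition_le prho.
  by move=> _; rewrite expr0n subn_eq0 ltnNge rle /= invr0 mulr0 ler01.
by move=> h; rewrite ler_pdivrMr ?exprn_gt0 ?ltr0n // mul1r -natrX ler_nat.
Qed.

Lemma Klim_bounds k r (rho : {set {set 'I_r}}) :
  (forall p q : nat, (0 < p)%N -> (p < q)%N -> (k p < k q)%N) ->
  (0 < r)%N -> finset.partition rho [set: 'I_r] -> cvgn (S_ratio R k rho) ->
  0 <= Klim R k rho <= 1.
Proof.
move=> k_incr r0 prho cv; apply/andP; split.
  by apply: limr_ge => //; apply: nearW => N; exact: S_ratio_ge0.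
by apply: limr_le => //; apply: nearW => N; exact: S_ratio_le1.
Qed.

(** Common value of the [r]-th moment, for [r > 0], under the uniform law and under every fine
    enough grid. *)
Definition mix_moment k r N : R := N%:R ^- r.+1 *
  \sum_(rho : {set {set 'I_r}} | finset.partition rho [set: 'I_r])
    (N ^_ #|rho| * #|S_set k N rho|)%:R.

(** Splitting [N ^+ r.+1] at the exponent [#|rho|] makes each summand a ratio tending to 1 times
    [S_ratio]. *)
Lemma cvg_mix_moment k r :
  (forall rho : {set {set 'I_r}}, finset.partition rho [set: 'I_r] -> cvgn (S_ratio R k rho)) ->
  mix_moment k r @ \oo -->
  \sum_(rho : {set {set 'I_r}} | finset.partition rho [set: 'I_r]) Klim R k rho.
Proof.
move=> hK.
have h : (fun N : nat => \sum_(rho : {set {set 'I_r}} | finset.partition rho [set: 'I_r])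
    ((N ^_ #|rho|)%:R / N%:R ^+ #|rho| : R) * S_ratio R k rho N) @ \oo -->
    \sum_(rho : {set {set 'I_r}} | finset.partition rho [set: 'I_r]) Klim R k rho.
  apply: cvg_sumr => rho prho; rewrite -[X in _ --> X]mul1r.
  by apply: cvgM; [exact: cvg_ffact_ratio | exact: hK].
apply: cvg_trans h; apply: near_eq_cvg.
near=> N; have N0 : (0 < N)%N by near: N; exact: nbhs_infty_gt.
have NR0 : (N%:R : R) != 0 by rewrite pnatr_eq0 -lt0n.
rewrite /mix_moment mulr_sumr; apply: eq_bigr => rho prho; rewrite /S_ratio natrM.
have rle := card_partition_le prho.
have -> : N%:R ^+ r.+1 = N%:R ^+ #|rho| * N%:R ^+ (r.+1 - #|rho|) :> R.
  by rewrite -exprD subnKC // ltnW.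
have := expf_neq0 #|rho| NR0; have := expf_neq0 (r.+1 - #|rho|) NR0.
by move: (N%:R ^+ _) (N%:R ^+ _) => x y x0 y0; field; rewrite x0 y0.
Unshelve. all: by end_near. Qed.

Lemma moment_seqE k r N : (0 < r)%N -> moment_seq R k r N = mix_moment k r N.
Proof.
move=> r0; rewrite /moment_seq unif_expectE.
apply: (@iter_expect_trX R _ xpredT) => // I w phi c _; exact: Rintegral_sum_cos.
Qed.

Lemma unif_expect_cst n (a : R) : unif_expect n (fun=> a) = a.
Proof.
elim: n => [//|n IH] /=; under eq_Rintegral do rewrite IH.
by rewrite Rintegral_cst //= lebesgue_measure_itv /= lte_fin ltr01 oppr0 adde0 mulr1.
Qed.

Lemma moment_seq0 k N : (0 < N)%N -> moment_seq R k 0 N = 1.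
Proof.
move=> N0; rewrite /moment_seq -[RHS](unif_expect_cst N 1); congr unif_expect.
by apply/funext => th; rewrite trX0.
Qed.

(** Truncated Dobinski formula: sorting the [N ^ r] maps by kernel writes [N ^+ r / N!] as a sum
    over partitions, in which [rho] receives exactly 1 when [N = #|rho|]. *)
Lemma card_partitions_le r :
  \sum_(rho : {set {set 'I_r}} | finset.partition rho [set: 'I_r]) (1 : R) <=
  \sum_(N < r.+1) N%:R ^+ r / N`!%:R.
Proof.
have E N : (N%:R : R) ^+ r / N`!%:R =
    \sum_(rho : {set {set 'I_r}} | finset.partition rho [set: 'I_r]) (N ^_ #|rho|)%:R / N`!%:R.
  have := @sum_ffun_ker R r N (fun=> 1); rewrite sumr_const -mulr_suml => <-.
  by rewrite card_ffun !card_ord natrX.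
under [leRHS]eq_bigr => N _ do rewrite E.
rewrite exchange_big /=; apply: ler_sum => rho prho.
have rle : (#|rho| < r.+1)%N by rewrite ltnS card_partition_le.
rewrite (bigD1 (Ordinal rle)) //= ffactnn divff ?pnatr_eq0 -?lt0n ?fact_gt0 //.
by rewrite lerDl sumr_ge0 // => i _; rewrite divr_ge0.
Qed.

End MomentLimit.

(** * Determinacy *)

Section Determinacy.
Context {R : realType}.
Implicit Types (s t x : R) (n r : nat).
Local Open Scope classical_set_scope.
Local Notation D := (`[0%R, +oo[%classic : set R).

Lemma exp_coeff_le_expR x n : 0 <= x -> x ^+ n / n`!%:R <= expR x.
Proof.
move=> x0; case: n => [|n].
  by rewrite expr0 fact0 divr1 -expR0 ler_expR.
by apply: le_trans (expR_ge1Dxn n x0); rewrite lerDr.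
Qed.

Lemma partial_sum_le_expR x n : 0 <= x -> \sum_(i < n) x ^+ i / i`!%:R <= expR x.
Proof.
move=> x0; have nd : nondecreasing_seq (series (exp_coeff x)).
  by apply: nondecreasing_series => i _ _; exact: exp_coeff_ge0.
have := nondecreasing_cvgn_le nd (@is_cvg_series_exp_coeff R x) n.
by rewrite /series /= big_mkord.
Qed.

(** By [x ^+ r / r! <= expR x] at [x = 2 * s * N], the term of index [N] is at most
    [2 ^- r * expR (2 * s) ^+ N / N!]; summing over [N] leaves at most
    [2 ^- r * expR (expR (2 * s))]. *)
Lemma cvg_dobinski_bound s : 0 <= s ->
  (fun r => s ^+ r / r`!%:R * \sum_(N < r.+1) (N%:R : R) ^+ r / N`!%:R) @ \oo --> (0 : R).
Proof.
move=> s0; pose C := expR (expR (2 * s)).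
apply: (@squeeze_cvgr _ _ _ _ (fun=> 0) (fun r => (2^-1 : R) ^+ r * C)); last 2 first.
- exact: cvg_cst.
- rewrite -[X in _ --> X](mul0r C); apply: cvgM; last exact: cvg_cst.
  by apply: cvg_expr; rewrite ger0_norm ?invr_ge0 // invf_lt1 ?ltr1n.
near=> r; apply/andP; split.
  by rewrite mulr_ge0 ?divr_ge0 ?exprn_ge0 ?sumr_ge0 // => i _; rewrite divr_ge0 ?exprn_ge0.
rewrite mulr_sumr (le_trans (y := \sum_(N < r.+1) 2^-1 ^+ r * (expR (2 * s) ^+ N / N`!%:R))) //.
  apply: ler_sum => N _.
  have -> : s ^+ r / r`!%:R * (N%:R ^+ r / N`!%:R) =
      2^-1 ^+ r * (((2 * s) * N%:R) ^+ r / r`!%:R / N`!%:R).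
    have h2 : (2^-1 : R) ^+ r * 2 ^+ r = 1 by rewrite -exprMn mulVf ?pnatr_eq0 // expr1n.
    rewrite !exprMn -[LHS]mul1r -[X in X * _ = _]h2.
    by move: (2^-1 ^+ r) (2 ^+ r) => y z; ring.
  rewrite ler_wpM2l ?exprn_ge0 ?invr_ge0 // ler_wpM2r ?invr_ge0 //.
  rewrite -expRM_natr; apply: exp_coeff_le_expR; rewrite !mulr_ge0 //.
rewrite -mulr_sumr ler_wpM2l ?exprn_ge0 ?invr_ge0 //.
by apply: partial_sum_le_expR; exact: expR_ge0.
Unshelve. all: by end_near. Qed.

(* [exp_tail n t] is [(-1)^n (e^{-t} - \sum_(i < n) (-t)^i / i!)]: this recursion makes
   its derivative [exp_tail n.-1], hence its sign, and its moments immediate. *)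
Fixpoint exp_tail n t : R :=
  if n is n'.+1 then t ^+ n' / n'`!%:R - exp_tail n' t else expR (- t).

Lemma is_derive_exp_tail n t : is_derive t 1 (exp_tail n.+1) (exp_tail n t).
Proof.
elim: n => [|n IH].
  have h : is_derive t 1 (expR \o -%R) (expR (- t) * -1).
    exact: is_derive1_comp.
  have -> : exp_tail 1 = cst 1 - (expR \o -%R).
    by apply/funext => u; rewrite /= expr0 fact0 divr1.
  by apply: is_derive_eq; rewrite /= mulrN1 sub0r opprK.
have -> : exp_tail n.+2 = (n.+1`!%:R^-1) \*: (fun u : R => u ^+ n.+1) - exp_tail n.+1.
  apply/funext => u; change (u ^+ n.+1 / n.+1`!%:R - exp_tail n.+1 u =
    n.+1`!%:R^-1 * u ^+ n.+1 - exp_tail n.+1 u).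
  by rewrite [X in X - _ = _]mulrC.
have hX : is_derive t 1 (fun u : R => u ^+ n.+1) ((n.+1%:R * t ^+ n) *: 1).
  by have := @is_deriveX _ _ _ n.+1 t 1 1 (is_derive_id t 1); rewrite exprfctE.
have := is_deriveB (is_deriveZ (n.+1`!%:R^-1) hX) IH.
congr is_derive; rewrite /GRing.scale /= mulr1 factS natrM; congr (_ - _).
by rewrite invfM mulrACA mulVf ?pnatr_eq0 // mul1r mulrC.
Qed.

(** Past the first, every tail vanishes at 0 and has the previous tail as derivative, nonnegative by
    induction. *)
Lemma exp_tail_ge0 n t : 0 <= t -> 0 <= exp_tail n t.
Proof.
elim: n t => [|n IH] t t0; first exact: expR_ge0.
have E0 : exp_tail n.+1 0 = 0.
  elim: n {IH} => [|n IH]; first by rewrite /= expr0 fact0 divr1 oppr0 expR0 subrr.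
  by change (0 ^+ n.+1 / n.+1`!%:R - exp_tail n.+1 0 = 0); rewrite IH expr0n mul0r subr0.
rewrite -E0; have [->//|tn0] := eqVneq t 0.
have d x : derivable (exp_tail n.+1) x 1 by case: (is_derive_exp_tail n x).
apply: (@ger0_derive1_le_cc R (exp_tail n.+1) 0 t) => //.
- move=> x /[!in_itv]/= /andP[x0 _]; rewrite derive1E.
  by case: (is_derive_exp_tail n x) => _ ->; rewrite IH // ltW.
- apply: continuous_subspaceT => x.
  by apply: differentiable_continuous; apply/derivable1_diffP.
- by rewrite in_itv/= lexx.
- by rewrite in_itv/= lexx t0.
Qed.

Lemma continuous_integrable_bounded (mu : probability R R) (f : R -> R) :
  continuous f -> (forall t, 0 <= t -> `|f t| <= 1) -> mu.-integrable D (EFin \o f).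
Proof.
move=> cf bf; apply: measurable_bounded_integrable => //.
- exact: le_lt_trans (probability_le1 _ _) (ltry _).
- by apply: measurable_funTS; exact: continuous_measurable_fun.
- exists 1; split => // M M1 t; rewrite /= in_itv/= andbT => t0.
  exact: le_trans (bf _ t0) (ltW M1).
Qed.

Lemma continuous_expRNM c : continuous (fun t : R => expR (- (c * t))).
Proof.
move=> t; apply: (@continuous_comp _ _ _ (fun t : R => - (c * t)) expR); last first.
  exact: continuous_expR.
by apply: cvgN; apply: cvgM; [exact: cvg_cst | exact: cvg_id].
Qed.

Lemma expRNM_le1 (c t : R) : 0 <= c -> 0 <= t -> expR (- (c * t)) <= 1.
Proof. by move=> c0 t0; rewrite -[leRHS]expR0 ler_expR oppr_le0 mulr_ge0. Qed.

Lemma laplace_integrable (mu : probability R R) s : 0 <= s ->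
  mu.-integrable D (EFin \o (fun t => expR (- (s * t)))).
Proof.
move=> s0; apply: continuous_integrable_bounded => [|t t0]; first exact: continuous_expRNM.
by rewrite ger0_norm ?expR_ge0 // expRNM_le1.
Qed.

Lemma integrable_pow (mu : probability R R) r (a : R) :
  (\int[mu]_(t in D) (t ^+ r)%:E)%E = a%:E ->
  mu.-integrable D (EFin \o (fun t : R => t ^+ r)).
Proof.
move=> h; apply/integrableP; split.
  apply/measurable_EFinP; apply: measurable_funTS; exact: measurable_funX.
rewrite (eq_integral (fun t : R => (t ^+ r)%:E)); first by rewrite h ltry.
by move=> t; rewrite inE /= in_itv/= andbT => t0; rewrite ger0_norm // exprn_ge0.
Qed.

Lemma exp_tail_integral (mu : probability R R) (m : nat -> R) s n :
  0 <= s -> (forall r, (\int[mu]_(t in D) (t ^+ r)%:E)%E = (m r)%:E) ->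
  mu.-integrable D (EFin \o (fun t => exp_tail n (s * t))) /\
  Rintegral mu D (fun t => exp_tail n.+1 (s * t)) =
    s ^+ n * m n / n`!%:R - Rintegral mu D (fun t => exp_tail n (s * t)).
Proof.
move=> s0 hm.
have ip r : mu.-integrable D (EFin \o (fun t : R => (s * t) ^+ r / r`!%:R)).
  have -> : (fun t : R => (s * t) ^+ r / r`!%:R) = (fun t : R => (s ^+ r / r`!%:R) * t ^+ r).
    by apply/funext => t; rewrite exprMn mulrAC.
  exact: (integrableZl (measurable_itv _) (s ^+ r / r`!%:R) (integrable_pow (hm r))).
have ie : mu.-integrable D (EFin \o (fun t => exp_tail n (s * t))).
  elim: n => [|n IH]; first exact: laplace_integrable.
  exact: (integrableB (measurable_itv _) (ip n) IH).
split => //=; rewrite RintegralB //; congr (_ - _).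
have -> : (fun t : R => (s * t) ^+ n / n`!%:R) = (fun t : R => (s ^+ n / n`!%:R) * t ^+ n).
  by apply/funext => t; rewrite exprMn mulrAC.
rewrite RintegralZl //; last exact: integrable_pow (hm n).
by rewrite /Rintegral hm /= mulrAC.
Qed.

(** Consecutive tails are nonnegative and add up to [(s * t) ^+ n / n!], so neither integral exceeds
    the moment term. *)
Lemma exp_tail_integral_bounds (mu : probability R R) (m : nat -> R) s n :
  0 <= s -> (forall r, (\int[mu]_(t in D) (t ^+ r)%:E)%E = (m r)%:E) ->
  0 <= Rintegral mu D (fun t => exp_tail n.+1 (s * t)) <= s ^+ n * m n / n`!%:R.
Proof.
move=> s0 hm; have D0 t : D t -> 0 <= s * t.
  by rewrite /= in_itv/= andbT => t0; rewrite mulr_ge0.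
have [_ ->] := exp_tail_integral n s0 hm.
rewrite gerBl -(exp_tail_integral n s0 hm).2.
by apply/andP; split; apply: Rintegral_ge0 => t /D0; exact: exp_tail_ge0.
Qed.

Definition laplace (mu : probability R R) s := Rintegral mu D (fun t => expR (- (s * t))).

(** By the recursion the difference of the [n]-th tail integrals changes only in sign with [n],
    while both integrals lie between 0 and a null sequence. *)
Lemma laplace_eq (mu nu : probability R R) (m : nat -> R) s : 0 <= s ->
  (forall r, (\int[mu]_(t in D) (t ^+ r)%:E)%E = (m r)%:E) ->
  (forall r, (\int[nu]_(t in D) (t ^+ r)%:E)%E = (m r)%:E) ->
  (fun r => s ^+ r * m r / r`!%:R) @ \oo --> (0 : R) ->
  laplace mu s = laplace nu s.
Proof.
move=> s0 hmu hnu m0.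
pose I (P : probability R R) n := Rintegral P D (fun t => exp_tail n (s * t)).
have diff n : `|I mu n - I nu n| = `|laplace mu s - laplace nu s|.
  elim: n => [//|n <-]; rewrite /I.
  rewrite (exp_tail_integral n s0 hmu).2 (exp_tail_integral n s0 hnu).2.
  by rewrite opprB addrC addrA subrK distrC.
apply/eqP; rewrite -subr_eq0 -normr_le0; apply/ler_addgt0Pr => e e0; rewrite add0r.
near \oo => n.
have := exp_tail_integral_bounds n s0 hmu; have := exp_tail_integral_bounds n s0 hnu.
rewrite -(diff n.+1) -/(I mu n.+1) -/(I nu n.+1).
have : `|0 - s ^+ n * m n / n`!%:R| < e.
  by near: n; move/cvgrPdist_lt : m0; exact.
rewrite sub0r normrN => /ltW/ler_normlP[_ he] /andP[a1 a2] /andP[b1 b2].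
by rewrite ler_norml; apply/andP; split; lra.
Unshelve. all: by end_near. Qed.

(** A factor [1 - expR (- (s * t))] turns an integral at [a] into the difference of those at [a] and
    [a + s], so the induction on [j] runs over all [a]. *)
Lemma laplace_poly_eq (mu nu : probability R R) :
  (forall s, 0 <= s -> laplace mu s = laplace nu s) ->
  forall s j a, 0 <= s -> 0 <= a ->
  Rintegral mu D (fun t => expR (- (a * t)) * (1 - expR (- (s * t))) ^+ j) =
  Rintegral nu D (fun t => expR (- (a * t)) * (1 - expR (- (s * t))) ^+ j).
Proof.
move=> hl s j; pose f a j t := expR (- (a * t)) * (1 - expR (- (s * t))) ^+ j.
rewrite -/f => a s0; elim: j a => [|j IH] a a0.
  under eq_Rintegral do rewrite expr0 mulr1.
  by under [RHS]eq_Rintegral do rewrite expr0 mulr1; exact: hl.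
have fint (P : probability R R) b i : 0 <= b -> P.-integrable D (EFin \o f b i).
  move=> b0; apply: continuous_integrable_bounded => [t|t t0].
    apply: cvgM; first exact: continuous_expRNM.
    apply: (@continuous_comp _ _ _ (fun t => 1 - expR (- (s * t))) (fun y => y ^+ i)).
      by apply: cvgB; [exact: cvg_cst | exact: continuous_expRNM].
    exact: exprn_continuous.
  have y0 : 0 <= 1 - expR (- (s * t)) by rewrite subr_ge0 expRNM_le1.
  rewrite ger0_norm ?mulr_ge0 ?expR_ge0 ?exprn_ge0 // mulr_ile1 ?expR_ge0 ?exprn_ge0 ?expRNM_le1 //.
  by rewrite exprn_ile1 // gerBl expR_ge0.
have E : f a j.+1 = (fun t => f a j t - f (a + s) j t).
  by apply/funext => t; rewrite /f exprS [(a + s) * t]mulrDl opprD expRD; ring.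
rewrite -/(f a j.+1) E !RintegralB ?fint ?addr_ge0 //.
by congr (_ - _); apply: IH; rewrite ?addr_ge0.
Qed.

Lemma probability_setIr_ge0 (P : probability R R) (A : set R) :
  P `]-oo, 0[%classic = 0%E -> measurable A -> P (A `&` D) = P A.
Proof.
move=> P0 mA; have : P (A `&` D) = (P (A `&` D) + 0)%E by rewrite adde0.
have : P (A `\` D) = 0%E.
  apply: (subset_measure0 _ _ _ P0) => //; first exact: measurableD.
  by move=> t [_] /=; rewrite !in_itv /= andbT => /negP; rewrite -ltNge.
by move=> e ->; rewrite -[X in (_ + X)%E]e addeC -measureDI.
Qed.

Definition step x t : R := (x < t)%R%:R.

Lemma step_indic x : step x = \1_(`]x, +oo[%classic : set R).
Proof. by apply/funext => t; rewrite indicE mem_setE in_itv /= andbT. Qed.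

Lemma measurable_step (A : set R) x : measurable_fun A (step x).
Proof.
by rewrite step_indic; apply: measurable_funTS; exact: measurable_indic.
Qed.

Lemma integral_step (P : probability R R) x :
  P `]-oo, 0[%classic = 0%E ->
  (\int[P]_(t in D) (step x t)%:E = P `]x, +oo[%classic)%E.
Proof.
by move=> P0; rewrite -(probability_setIr_ge0 P0) // -integral_indic // step_indic.
Qed.

Lemma bernoulli_onem (y : R) n : 0 <= y <= 1 -> 1 - n%:R * y <= (1 - y) ^+ n.
Proof.
move=> /andP[y0 y1]; elim: n => [|n IH]; first by rewrite mul0r subr0.
rewrite exprS; apply: (@le_trans _ _ ((1 - y) * (1 - n%:R * y))).
  have : 0 <= (n%:R : R) * (y * y) by rewrite !mulr_ge0.
  by rewrite -natr1; nra.
by rewrite ler_wpM2l // subr_ge0.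
Qed.

(** With [j] the exponent, [j * expR (- (n * t))] behaves like [n * expR (n * (x - t))], which tends
    to 0 for [t > x] and to infinity for [t <= x]. The factor [n] in front decides the case
    [t = x]. *)
Definition step_approx x n t : R :=
  (1 - expR (- (n%:R * t))) ^+ Num.truncn (n%:R * expR (n%:R * x)).

Lemma step_approx_bounds x n t : 0 <= t -> 0 <= step_approx x n t <= 1.
Proof.
move=> t0; have y0 : 0 <= 1 - expR (- (n%:R * t)) by rewrite subr_ge0 expRNM_le1.
by rewrite exprn_ge0 //= exprn_ile1 // gerBl expR_ge0.
Qed.

Lemma cvg_step_approx x t : 0 <= x -> 0 <= t ->
  step_approx x n t @[n --> \oo] --> step x t.
Proof.
move=> x0 t0; rewrite /step; have [xt|tx] := ltP x t.
  pose d := t - x; have d0 : 0 < d by rewrite subr_gt0.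
  (* Bernoulli's inequality gives a defect of at most [n / expR (n * d)], and
     [expR (n * d) >= (n * d) ^+ 2 / 2] bounds it by [2 / (d ^+ 2 * n)]. *)
  apply: (@squeeze_cvgr _ _ _ _ (fun n => 1 - (2 / d ^+ 2) * (n%:R)^-1) (fun=> 1)).
  - near=> n; have /andP[_ ->] := step_approx_bounds x n t0; rewrite andbT.
    have n0 : (0 < n)%N by near: n; exact: nbhs_infty_gt.
    have nR0 : (0 : R) < n%:R by rewrite ltr0n.
    apply: le_trans (bernoulli_onem _ _); last by rewrite expR_ge0 expRNM_le1.
    rewrite lerD2l lerN2.
    apply: (@le_trans _ _ ((n%:R * expR (n%:R * x)) * expR (- (n%:R * t)))).
      rewrite ler_wpM2r ?expR_ge0 //.
      by have /andP[] := truncn_itv (mulr_ge0 (ler0n R n) (expR_ge0 (n%:R * x))).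
    have -> : n%:R * expR (n%:R * x) * expR (- (n%:R * t)) = n%:R / expR (n%:R * d).
      by rewrite -mulrA -expRD -expRN /d; congr (_ * expR _); ring.
    rewrite ler_pdivrMr ?expR_gt0 //.
    have nd0 : 0 <= n%:R * d by rewrite mulr_ge0 // ltW.
    have := exp_coeff_le_expR 2 nd0.
    move: (expR _) => e he; have h2 : 2 / d ^+ 2 / n%:R * ((n%:R * d) ^+ 2 / 2`!%:R) = n%:R.
      by rewrite (_ : 2`!%:R = 2) //; field; rewrite !gt_eqF.
    by rewrite -[leLHS]h2 ler_wpM2l // !mulr_ge0 ?invr_ge0 ?exprn_ge0 // ltW.
  - rewrite -[X in _ --> X]subr0 -[X in _ - X](mulr0 (2 / d ^+ 2)).
    by apply: cvgB; [exact: cvg_cst | apply: cvgM; [exact: cvg_cst | exact: cvg_natrV]].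
  - exact: cvg_cst.
(* As [1 - y <= expR (- y)], the power is at most [expR (- (y * j))]. From
   [j + 1 > n * expR (n * x)] and [y >= expR (- (n * x))] follows [y * j >= n - 1], hence the bound
   [expR (1 - n)]. *)
apply: (@squeeze_cvgr _ _ _ _ (fun=> 0) (fun n => expR 1 * expR (- n%:R))).
- near=> n; have /andP[-> _] /= := step_approx_bounds x n t0.
  rewrite /step_approx; set y := expR _; set j := Num.truncn _.
  have y1 : 0 <= 1 - y by rewrite subr_ge0 expRNM_le1.
  apply: (@le_trans _ _ (expR (- y) ^+ j)).
    by rewrite lerXn2r ?nnegrE ?expR_ge0 // expR_ge1Dx.
  rewrite -expRM_natr -expRD ler_expR.
  have hj : n%:R * expR (n%:R * x) < j%:R + 1.
    have /andP[_] := truncn_itv (mulr_ge0 (ler0n R n) (expR_ge0 (n%:R * x))).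
    by rewrite natr1.
  have hy : expR (- (n%:R * x)) <= y by rewrite ler_expR lerN2 ler_wpM2l.
  have hx : expR (- (n%:R * x)) * expR (n%:R * x) = 1 by rewrite -expRD addNr expR0.
  have hx1 : expR (- (n%:R * x)) <= 1 by exact: expRNM_le1.
  have hx0 := expR_ge0 (- (n%:R * x)).
  have j0 : 0 <= (j%:R : R) by [].
  move: hj hy hx hx1 hx0 j0; move: (expR _) (expR (n%:R * x)) (j%:R : R) => a b J.
  move=> hj hy hx hx1 hx0 J0.
  have : a * J <= y * J by rewrite ler_wpM2r.
  have : a * (n%:R * b) <= a * (J + 1) by rewrite ler_wpM2l // ltW.
  by rewrite mulrCA hx mulr1; lra.
- exact: cvg_cst.
- rewrite -[X in _ --> X](mulr0 (expR 1)).
  by apply: cvgM; [exact: cvg_cst | exact: cvgn_expR].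
Unshelve. all: by end_near. Qed.

Lemma cvg_integral_step_approx (P : probability R R) x : 0 <= x ->
  P `]-oo, 0[%classic = 0%E ->
  (Rintegral P D (step_approx x n))%:E @[n --> \oo] --> P `]x, +oo[%classic.
Proof.
move=> x0 P0; rewrite -integral_step //.
have cstep n : continuous (step_approx x n).
  move=> t; apply: (@continuous_comp _ _ _ (fun t => 1 - expR (- (n%:R * t)))
    (fun y => y ^+ Num.truncn (n%:R * expR (n%:R * x)))); last exact: exprn_continuous.
  by apply: cvgB; [exact: cvg_cst | exact: continuous_expRNM].
have istep n : P.-integrable D (EFin \o step_approx x n).
  apply: continuous_integrable_bounded => // t t0.
  by have /andP[h0 h1] := step_approx_bounds x n t0; rewrite ger0_norm.
have -> : (fun n => (Rintegral P D (step_approx x n))%:E) =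
    (fun n => \int[P]_(t in D) (step_approx x n t)%:E)%E.
  by apply/funext => n; rewrite /Rintegral fineK //; exact: (integrable_fin_num _ (istep n)).
have mD : measurable D by [].
have [] := @dominated_convergence _ _ _ P D mD (fun n t => (step_approx x n t)%:E)
  (fun t => (step x t)%:E) (fun=> 1%E) => //.
- move=> n; have /integrableP[] := istep n; exact.
- by apply/measurable_EFinP; exact: measurable_step.
- apply: aeW => t; rewrite /= in_itv /= andbT => t0; apply/fine_cvgP; split; first by apply: nearW.
  exact: cvg_step_approx.
- apply: (@continuous_integrable_bounded _ (fun=> 1)) => [t|t _]; first exact: cvg_cst.
  by rewrite normr1.
- apply: aeW => t n; rewrite /= in_itv /= andbT => t0.
  by have /andP[h0 h1] := step_approx_bounds x n t0; rewrite lee_fin ger0_norm.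
Qed.

(** Equal moments give equal Laplace transforms, hence equal integrals of [step_approx] and equal
    tails; upper half-lines are closed under intersection and generate the Borel sets. *)
Lemma moment_determinacy (mu nu : probability R R) (m : nat -> R) :
  mu `]-oo, 0[%classic = 0%E -> nu `]-oo, 0[%classic = 0%E ->
  (forall r, (\int[mu]_(t in D) (t ^+ r)%:E)%E = (m r)%:E) ->
  (forall r, (\int[nu]_(t in D) (t ^+ r)%:E)%E = (m r)%:E) ->
  (forall s, 0 <= s -> (fun r => s ^+ r * m r / r`!%:R) @ \oo --> (0 : R)) ->
  forall A, measurable A -> mu A = nu A.
Proof.
move=> mu0 nu0 hmu hnu hm.
have lap s : 0 <= s -> laplace mu s = laplace nu s.
  by move=> s0; apply: laplace_eq (hm s s0).
have tailE x : mu `]x, +oo[%classic = nu `]x, +oo[%classic.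
  have [x0|x0] := leP 0 x.
    have := cvg_integral_step_approx x0 mu0; have := cvg_integral_step_approx x0 nu0.
    have -> : (fun n => (Rintegral nu D (step_approx x n))%:E) =
              (fun n => (Rintegral mu D (step_approx x n))%:E).
      apply/funext => n; congr (_%:E).
      have E (P : probability R R) : Rintegral P D (step_approx x n) =
          Rintegral P D (fun t => expR (- (0 * t)) * step_approx x n t).
        by apply: eq_Rintegral => t _; rewrite mul0r oppr0 expR0 mul1r.
      by rewrite !E; apply/esym/laplace_poly_eq.
    by move=> h1 h2; exact: (cvg_unique _ h2 h1).
  have allD (P : probability R R) : P `]-oo, 0[%classic = 0%E -> P `]x, +oo[%classic = 1%E.
    move=> P0; rewrite -(probability_setT P) -[LHS](probability_setIr_ge0 P0) //.
    rewrite -[RHS](probability_setIr_ge0 P0) // setTI; congr (P _).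
    apply/seteqP; split => t /=; rewrite !in_itv /= !andbT; first by case.
    by move=> t0; split => //; exact: lt_le_trans t0.
  by rewrite !allD.
move=> A mA.
(* An exhausting sequence of generators of finite measure, as uniqueness of measures requires. *)
pose g n : set R := `](- n%:R)%R, +oo[%classic.
have setIG : setI_closed (@RGenOInfty.G R).
  move=> _ _ [a ->] [b ->]; exists (Num.max a b).
  apply/seteqP; split => t /=; rewrite !in_itv /= !andbT gt_max; first by case=> -> ->.
  by move=> /andP[].
have Gg n : @RGenOInfty.G R (g n) by exists (- n%:R).
have gT : \bigcup_n g n = setT.
  apply/seteqP; split => // t _; exists (Num.truncn `|t|).+1 => //=.
  rewrite /g /= in_itv /= andbT ltrNl; apply: le_lt_trans (ler_norm _) _; rewrite normrN.
  by have /andP[] := truncn_itv (normr_ge0 t).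
have GE B : @RGenOInfty.G R B -> mu B = nu B by move=> [a ->]; exact: tailE.
have fin n : (mu (g n) < +oo)%E by rewrite ltey_eq fin_num_measure // /g; exact: measurable_itv.
exact: (@measure_unique _ _ _ (@RGenOInfty.G R) g (RGenOInfty.measurableE R)
  setIG Gg gT mu nu GE fin A mA).
Qed.

End Determinacy.

(** * Existence *)

Section CdfExistence.
Context {R : realType}.
Variable F : R -> R.
Hypothesis F_nd : nondecreasing F.
Hypothesis F_rc : right_continuous F.
Hypothesis F_Ny : (F @ -oo%R --> (0 : R))%classic.
Hypothesis F_y : (F @ +oo%R --> (1 : R))%classic.

#[local] HB.instance Definition _ := isCumulative.Build R _ R F F_nd F_rc.
#[local] HB.instance Definition _ := isCumulativeBounded.Build R 0 1 F F_Ny F_y.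

(** The identity as a random variable: its law under the Lebesgue-Stieltjes measure of [F] is the
    wanted probability. *)
Let idTR : measurableTypeR R -> R := idfun.

#[local] HB.instance Definition _ :=
  @isMeasurableFun.Build _ _ _ _ idTR (@measurable_id _ _ [set: _]%classic).

Lemma probability_of_cdf :
  exists mu : probability R R, forall x, mu `]-oo, x]%classic = (F x)%:E.
Proof.
exists (distribution (lebesgue_stieltjes_measure F) (idTR : {mfun _ >-> _})) => x.
by rewrite -cdf_lebesgue_stieltjes_id.
Qed.

End CdfExistence.

(** * Limits along an ultrafilter *)

Section UltraLimit.
Context {R : realType}.
Local Open Scope classical_set_scope.

(** Compactness of [[a, b]] gives a cluster point. The preimage of a neighbourhood of it or the
    complement of that preimage belongs to [U], and the latter contradicts clustering. *)
Lemma ultra_bounded_cvg (T : Type) (U : set_system T) (u : T -> R) (a b : R) :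
  UltraFilter U -> (forall n, a <= u n <= b) -> cvg (u @ U).
Proof.
move=> UU u01; have UP : ProperFilter U by exact: ultra_proper.
have Uab : U (u @^-1` `[a, b]) by apply: filterE => n; rewrite /= in_itv; exact: u01.
have [] := @segment_compact R a b (u @ U) _ Uab.
move=> l [_ clu]; apply/cvg_ex; exists l => B nB.
have [//|UnB] := in_ultra_setVsetC (u @^-1` B) UU.
by have [y [/= nBy By]] := clu (~` B) B UnB nB.
Qed.

End UltraLimit.

(** * Comparison of powers with step functions *)

Section GridSteps.
Context {R : realType}.
Implicit Types (d t : R) (K r : nat).

(** Increment of the power function across the [i]-th cell of mesh [d]: the weights telescope, so
    weighted steps form staircases approximating [t ^+ r]. *)
Definition grid_coef d r i : R := (i.+1%:R * d) ^+ r - (i%:R * d) ^+ r.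

Lemma grid_coef_ge0 d r i : 0 <= d -> 0 <= grid_coef d r i.
Proof.
by move=> d0; rewrite subr_ge0 lerXn2r ?nnegrE ?mulr_ge0 // ler_wpM2r // ler_nat.
Qed.

Lemma sum_grid_coef d r K : (0 < r)%N -> \sum_(i < K) grid_coef d r i = (K%:R * d) ^+ r.
Proof.
move=> r0; rewrite -(big_mkord xpredT (grid_coef d r)) /grid_coef telescope_sumr //.
by rewrite mul0r expr0n gtn_eqF //= subr0.
Qed.

(** Jumps at the right ends of the cells come late, so the staircase stays below the power; in
    [grid_upper] the jumps at left ends come early, but cover only [t <= K * d]. *)
Lemma grid_lower d r K t : 0 <= d -> 0 <= t -> (0 < r)%N ->
  \sum_(i < K) grid_coef d r i * step (i.+1%:R * d) t <= t ^+ r.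
Proof.
move=> d0 t0 r0; elim: K => [|K IH]; first by rewrite big_ord0 exprn_ge0.
have [tK|Kt] := leP t (K.+1%:R * d).
  by rewrite big_ord_recr /= {2}/step ltNge tK mulr0 addr0.
apply: (@le_trans _ _ ((K.+1%:R * d) ^+ r)); last first.
  by rewrite lerXn2r ?nnegrE ?mulr_ge0 // ltW.
rewrite -sum_grid_coef // ler_sum // => i _.
by rewrite ler_piMr ?grid_coef_ge0 // /step lern1 leq_b1.
Qed.

Lemma grid_upper d r K t : 0 <= d -> 0 <= t -> t <= K%:R * d -> (0 < r)%N ->
  t ^+ r <= \sum_(i < K) grid_coef d r i * step (i%:R * d) t.
Proof.
move=> d0 t0 tK r0; elim: K tK => [|K IH] tK.
  have -> : t = 0 by apply/eqP; rewrite eq_le t0 andbT; rewrite mul0r in tK.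
  by rewrite big_ord0 expr0n gtn_eqF.
have [tK'|Kt] := leP t (K%:R * d).
  rewrite big_ord_recr /= (le_trans (IH tK')) // lerDl mulr_ge0 ?grid_coef_ge0 //.
apply: (@le_trans _ _ ((K.+1%:R * d) ^+ r)).
  by rewrite lerXn2r ?nnegrE ?mulr_ge0.
rewrite -sum_grid_coef // ler_sum // => i _.
rewrite /step (le_lt_trans _ Kt) ?mulr1 // ler_wpM2r // ler_nat -ltnS.
exact: ltn_ord.
Qed.

(** As [t + 2 * d = (1 - d) * t + d * (t + 2)], convexity of the power gives the first estimate;
    then [t + 2] is at most 4 or at most [2 * t]. The shift [2 * d] is the two cells lost in the
    upper bound for moments. *)
Lemma exprD_le d t r : 0 <= d <= 1 -> 0 <= t ->
  (t + 2 * d) ^+ r <= t ^+ r + d * (4 ^+ r + 2 ^+ r * t ^+ r).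
Proof.
move=> /andP[d0 d1] t0.
have cvx : (t + 2 * d) ^+ r <= (1 - d) * t ^+ r + d * (t + 2) ^+ r.
  elim: r => [|r IH]; first by rewrite !expr0; lra.
  have mono : t ^+ r <= (t + 2) ^+ r by rewrite lerXn2r ?nnegrE; lra.
  have a0 : 0 <= t ^+ r by exact: exprn_ge0.
  have h : (t + 2 * d) * (t + 2 * d) ^+ r <=
      (t + 2 * d) * ((1 - d) * t ^+ r + d * (t + 2) ^+ r).
    by rewrite ler_wpM2l //; lra.
  rewrite !exprS; apply: le_trans h _.
  move: (t ^+ r) ((t + 2) ^+ r) mono a0 => A B AB A0.
  have : 0 <= d * (1 - d) * (B - A) by rewrite !mulr_ge0 // subr_ge0.
  nra.
have : (t + 2) ^+ r <= 4 ^+ r + 2 ^+ r * t ^+ r.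
  have [t2|t2] := leP t 2.
    apply: (@le_trans _ _ (4 ^+ r)); first by rewrite lerXn2r ?nnegrE; lra.
    by rewrite lerDl mulr_ge0 ?exprn_ge0.
  apply: (@le_trans _ _ (2 ^+ r * t ^+ r)).
    by rewrite -exprMn lerXn2r ?nnegrE; lra.
  by rewrite lerDr exprn_ge0.
have : 0 <= t ^+ r by exact: exprn_ge0.
by move: cvx; move: (_ ^+ r) ((t + 2) ^+ r) (t ^+ r) => X Y Z; nra.
Qed.

End GridSteps.

(** * Moments from tails, and the limit law *)

Section MomentExistence.
Context {R : realType}.
Implicit Types (x y t : R) (r K : nat).
Local Open Scope classical_set_scope.
Local Notation D := (`[0%R, +oo[%classic : set R).

Lemma integral_step_sum (P : probability R R) K (c x : nat -> R) :
  P `]-oo, 0[%classic = 0%E -> (forall i, 0 <= c i) ->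
  (\int[P]_(t in D) (\sum_(i < K) c i * step (x i) t)%:E =
   \sum_(i < K) (c i)%:E * P `](x i), +oo[)%E.
Proof.
move=> P0 c0.
have mstep y : measurable_fun D (EFin \o step y).
  by apply/measurable_EFinP; exact: measurable_step.
transitivity (\int[P]_(t in D) \sum_(i < K) ((c i)%:E * (step (x i) t)%:E))%E.
  by apply: eq_integral => t _; rewrite -sumEFin.
rewrite ge0_integral_sum //; last 2 first.
- by move=> i; apply: (measurable_funeM (c i)%:E) => //; exact: mstep.
- by move=> i t _; rewrite -EFinM lee_fin mulr_ge0.
apply: eq_bigr => i _; rewrite ge0_integralZl //; last 3 first.
- exact: mstep.
- by move=> t _; rewrite lee_fin.
- by rewrite lee_fin.
by rewrite integral_step.
Qed.

(** [H] plays a limit of tails and [P] has its right-continuous version as tail. Lower staircases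
    and Fatou's lemma bound the integral by [m r]. A finite staircase cannot dominate a power at
    infinity, so the upper comparison carries an error [a * t ^+ r.+1]. *)
Lemma moments_of_tail_bounds (P : probability R R) (H : R -> R) (m : nat -> R) r :
  P `]-oo, 0[%classic = 0%E -> (0 < r)%N ->
  (forall x, P `]x, +oo[ <= (H x)%:E)%E ->
  (forall x y, (x < y)%R -> (H y)%:E <= P `]x, +oo[)%E ->
  (forall K (c x : nat -> R), (forall i, 0 <= c i) ->
    (forall t, 0 <= t -> \sum_(i < K) c i * step (x i) t <= t ^+ r) ->
    \sum_(i < K) c i * H (x i) <= m r) ->
  (forall K (c x : nat -> R) a, (forall i, 0 <= c i) ->
    (forall t, 0 <= t -> t ^+ r <= \sum_(i < K) c i * step (x i) t + a * t ^+ r.+1) ->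
    m r <= \sum_(i < K) c i * H (x i) + a * m r.+1) ->
  (\int[P]_(t in D) (t ^+ r)%:E = (m r)%:E)%E.
Proof.
move=> P0 r0 PH HP lower upper.
pose dl n : R := (n%:R)^-1.
have dl0 n : 0 <= dl n by rewrite invr_ge0.
(* Mesh [1 / n] with [n * n] cells: the staircase covers [[0, n]] while getting finer. *)
pose sg n t := \sum_(i < n * n) grid_coef (dl n) r i * step (i.+1%:R * dl n) t.
have sg0 n t : 0 <= sg n t by rewrite sumr_ge0 // => i _; rewrite mulr_ge0 ?grid_coef_ge0.
have mD : measurable D by [].
have msum K (c x : nat -> R) :
    measurable_fun D (EFin \o (fun t => \sum_(i < K) c i * step (x i) t)).
  apply/measurable_EFinP; apply: measurable_sum => i.
  by apply: measurable_funM; [exact: measurable_cst | exact: measurable_step].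
have cvgsg t : 0 <= t -> sg n t @[n --> \oo] --> t ^+ r.
  move=> t0; have sgt n : sg n t <= t ^+ r by exact: grid_lower.
  have [->|tn0] := eqVneq t 0.
    apply: (@squeeze_cvgr _ _ _ _ (fun=> 0) (fun=> 0)).
    - near=> n; rewrite sg0 /=; have := @grid_lower R (dl n) r (n * n) 0 (dl0 n) (lexx _) r0.
      by rewrite expr0n gtn_eqF.
    - by rewrite expr0n gtn_eqF //; exact: cvg_cst.
    - by rewrite expr0n gtn_eqF //; exact: cvg_cst.
  have tp : 0 < t by rewrite lt_def tn0.
  apply: (@squeeze_cvgr _ _ _ _ (fun n => (t - dl n) ^+ r) (fun=> t ^+ r)).
  - near=> n; rewrite sgt andbT.
    have n0 : (0 < n)%N by near: n; exact: nbhs_infty_gt.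
    have tn : t <= n%:R by near: n; exact: nbhs_infty_ger.
    have dt : dl n < t.
      near: n; have := @cvg_natrV R; move/cvgrPdist_lt => /(_ _ tp); apply: filterS => n.
      by rewrite sub0r normrN ger0_norm.
    (* A shift of [t] by one mesh turns right-end jumps into left-end ones, so [grid_upper] bounds
       [sg n t] below by [(t - 1 / n) ^+ r]. *)
    have E i : step (i%:R * dl n) (t - dl n) = step (i.+1%:R * dl n) t.
      by rewrite /step ltrBrDr -natr1 mulrDl mul1r.
    rewrite /sg; under eq_bigr do rewrite -E.
    apply: grid_upper => //; first by rewrite subr_ge0 ltW.
    rewrite natrM -mulrA divff ?pnatr_eq0 -?lt0n // mulr1.
    by rewrite lerBlDr (le_trans tn) // lerDl.
  - have -> : t ^+ r = (t - 0) ^+ r by rewrite subr0.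
    apply: (@cvg_comp _ _ _ (fun n => t - dl n) (fun y => y ^+ r)); last exact: exprn_continuous.
    by apply: cvgB; [exact: cvg_cst | exact: cvg_natrV].
  - exact: cvg_cst.
have le_m : (\int[P]_(t in D) (t ^+ r)%:E <= (m r)%:E)%E.
  have -> : (\int[P]_(t in D) (t ^+ r)%:E = \int[P]_(t in D) limn_einf (fun n => (sg n t)%:E))%E.
    apply: eq_integral => t; rewrite inE /= in_itv /= andbT => t0.
    have h : (sg n t)%:E @[n --> \oo] --> (t ^+ r)%:E.
      by apply/fine_cvgP; split; [apply: nearW | exact: cvgsg].
    by rewrite is_cvg_limn_einfE; [rewrite (cvg_lim _ h) | apply/cvg_ex; exists (t ^+ r)%:E].
  apply: le_trans (fatou P mD _ _) _.
  - by move=> n; exact: (msum _ (grid_coef (dl n) r) (fun i => i.+1%:R * dl n)).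
  - by move=> n t _; rewrite lee_fin.
  have le n : (\int[P]_(t in D) (sg n t)%:E <= (m r)%:E)%E.
    rewrite (@integral_step_sum P _ (grid_coef (dl n) r) (fun i => i.+1%:R * dl n)) //; last first.
      by move=> i; exact: grid_coef_ge0.
    apply: (@le_trans _ _ (\sum_(i < n * n) grid_coef (dl n) r i * H (i.+1%:R * dl n))%:E).
      rewrite -sumEFin; apply: lee_sum => i _; rewrite EFinM lee_wpmul2l //.
      by rewrite lee_fin grid_coef_ge0.
    rewrite lee_fin; apply: (lower _ (grid_coef (dl n) r) (fun i => i.+1%:R * dl n)) => [i|t t0].
      exact: grid_coef_ge0.
    exact: grid_lower.
  rewrite limn_einf_lim; apply: lime_le; first exact: is_cvg_einfs.
  by apply: nearW => n; apply: le_trans (le n); apply: ereal_inf_lbound; exists n => //=.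
have mpow q : measurable_fun D (EFin \o (fun t : R => t ^+ q)).
  by apply/measurable_EFinP; apply: measurable_funTS; exact: exprn_measurable.
have pow0 q t : D t -> (0 <= (t ^+ q)%:E)%E.
  by rewrite /= in_itv /= andbT => t0; rewrite lee_fin exprn_ge0.
pose I := fine (\int[P]_(t in D) (t ^+ r)%:E)%E.
have IE : (\int[P]_(t in D) (t ^+ r)%:E)%E = I%:E.
  rewrite /I fineK // ge0_fin_numE; first exact: le_lt_trans le_m (ltry _).
  by apply: integral_ge0 => t; exact: pow0.
have I0 : 0 <= I by rewrite /I fine_ge0 // integral_ge0 // => t; exact: pow0.
have PD1 : (P D <= 1)%E by exact: probability_le1.
suff le_I : m r <= I by apply/eqP; rewrite eq_le le_m IE lee_fin.
have bound n : (0 < n)%N -> m r <= I + (dl n) * (4 ^+ r + 2 ^+ r * I + m r.+1).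
  move=> n0; have nd : n%:R * dl n = 1 by rewrite divff // pnatr_eq0 -lt0n.
  have dln1 : dl n <= 1 by rewrite invf_le1 ?ler1n ?ltr0n.
  have dlp : 0 < dl n by rewrite invr_gt0 ltr0n.
  have cg i : 0 <= grid_coef (dl n) r i by exact: grid_coef_ge0.
  have := upper (n * n)%N (grid_coef (dl n) r) (fun i => i%:R * dl n) (dl n) cg.
  move=> /(_ _)/le_trans; apply.
    move=> t t0; have [tn|nt] := leP t n%:R.
      rewrite -[leLHS]addr0 lerD ?mulr_ge0 ?exprn_ge0 // grid_upper //.
      by rewrite natrM -mulrA nd mulr1.
    (* Beyond [n] the staircase is dropped, and [1 <= t / n] gives [t ^+ r <= t ^+ r.+1 / n]. *)
    rewrite -[leLHS]add0r lerD ?sumr_ge0 // => [i _|]; first by rewrite mulr_ge0.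
    rewrite exprS mulrA ler_peMl ?exprn_ge0 // -nd mulrC ler_wpM2l // ltW //.
  rewrite mulrDr addrA lerD2r.
  (* One mesh to the left provides the strict inequality under which [H] is dominated by the tails
     of [P]. *)
  rewrite -lee_fin -sumEFin; pose xm (i : nat) : R := (i%:R - 1) * dl n.
  apply: (@le_trans _ _ (\sum_(i < n * n) (grid_coef (dl n) r i)%:E *
      P `](xm i), +oo[)%E).
    apply: lee_sum => i _; rewrite EFinM lee_wpmul2l ?lee_fin //; apply: HP.
    by rewrite /xm ltr_pM2r // ltrBlDr ltrDl.
  rewrite -(@integral_step_sum P (n * n) (grid_coef (dl n) r) xm) //.
  apply: (@le_trans _ _ (\int[P]_(t in D)
      ((dl n * 4 ^+ r)%:E + (1 + dl n * 2 ^+ r)%:E * (t ^+ r)%:E))%E).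
    apply: ge0_le_integral => //.
    - by move=> t _; rewrite lee_fin sumr_ge0 // => i _; rewrite mulr_ge0.
    - exact: (msum _ (grid_coef (dl n) r) xm).
    - apply: emeasurable_funD; first exact: measurable_cst.
      by apply: (measurable_funeM (1 + dl n * 2 ^+ r)%:E); exact: mpow.
    move=> t; rewrite /= in_itv /= andbT => t0; rewrite -EFinM -EFinD lee_fin.
    (* The jumps at [(i - 1) * dl n] are right-end jumps seen from [t + 2 * dl n], so [grid_lower]
       and [exprD_le] apply. *)
    have E (i : nat) : step (xm i) t = step (i.+1%:R * dl n) (t + 2 * dl n).
      rewrite /step /xm -ltrBlDr -natr1; congr ((_ < _)%R%:R); ring.
    under eq_bigr do rewrite E.
    apply: le_trans (grid_lower _ _ _ _) _ => //; first by rewrite addr_ge0 // mulr_ge0.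
    have d01 : 0 <= dl n <= 1 by rewrite dl0.
    by apply: le_trans (exprD_le r d01 t0) _; rewrite le_eqVlt; apply/orP; left; apply/eqP; ring.
  rewrite ge0_integralD //; last 3 first.
  - by move=> t _; rewrite lee_fin mulr_ge0 ?exprn_ge0.
  - by move=> t /(pow0 r) h; rewrite mule_ge0 // lee_fin addr_ge0 ?mulr_ge0 ?exprn_ge0.
  - by apply: (measurable_funeM (1 + dl n * 2 ^+ r)%:E); exact: mpow.
  rewrite integral_cst // ge0_integralZl //; last 3 first.
  - exact: mpow.
  - by move=> t; exact: pow0.
  - by rewrite lee_fin addr_ge0 ?mulr_ge0 ?exprn_ge0.
  rewrite IE -EFinM.
  apply: (@le_trans _ _ ((dl n * 4 ^+ r)%:E * 1 + ((1 + dl n * 2 ^+ r) * I)%:E)%E).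
    by rewrite leeD2r // lee_wpmul2l // lee_fin mulr_ge0 ?exprn_ge0.
  by rewrite mule1 -EFinD lee_fin le_eqVlt; apply/orP; left; apply/eqP; ring.
have h : (fun n => I + dl n * (4 ^+ r + 2 ^+ r * I + m r.+1)) @ \oo --> I.
  rewrite -[X in _ --> X]addr0 -[X in _ --> _ + X](mul0r (4 ^+ r + 2 ^+ r * I + m r.+1)).
  by apply: cvgD; [exact: cvg_cst | apply: cvgM; [exact: cvg_natrV | exact: cvg_cst]].
apply: (cvgr_to_ge h); near=> n; apply: bound; near: n; exact: nbhs_infty_gt.
Unshelve. all: by end_near. Qed.

(** [L N] models integration against a finitely supported law on [[0, oo)]: comparing functions only
    at [t >= 0] encodes the support, and both steps and powers can be integrated. *)
Variables (L : nat -> (R -> R) -> R) (m : nat -> R).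
Hypothesis L_mono : forall N f g, (forall t, 0 <= t -> f t <= g t) -> L N f <= L N g.
Hypothesis L_lin : forall N a f g, L N (fun t => a * f t + g t) = a * L N f + L N g.
Hypothesis L_1 : forall N, L N (fun=> 1) = 1.
Hypothesis L_cvg : forall r, (fun N => L N (fun t => t ^+ r)) @ \oo --> m r.

Lemma functional_sum N K (c x : nat -> R) (g : R -> R) :
  L N (fun t => \sum_(i < K) c i * step (x i) t + g t) =
  \sum_(i < K) c i * L N (step (x i)) + L N g.
Proof.
elim: K g => [|K IH] g.
  by rewrite big_ord0 add0r; congr (L N _); apply/funext => t; rewrite big_ord0 add0r.
rewrite big_ord_recr /= -addrA -L_lin -IH; congr (L N _); apply/funext => t.
by rewrite big_ord_recr /= addrA.
Qed.

Lemma functional_0 N : L N (fun=> 0) = 0.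
Proof.
have E := L_lin N (-1) (fun=> 1) (fun=> 1); rewrite L_1 mulN1r addNr in E.
rewrite -[RHS]E.
by congr (L N _); apply/funext => t; rewrite mulN1r addNr.
Qed.

Lemma functional_step_bounds N x : 0 <= L N (step x) <= 1.
Proof.
apply/andP; split.
  by rewrite -(functional_0 N); apply: L_mono => t _; rewrite /step.
by rewrite -[leRHS](L_1 N); apply: L_mono => t _; rewrite /step lern1 leq_b1.
Qed.

(** The ultrafilter limits [H] of the tails are antitone, equal 1 on the negatives and decay by
    Markov's inequality; their right limits [G] are the tails of the law. *)
Lemma moment_existence : exists mu : probability R R,
  mu `]-oo, 0[ = 0%E /\ forall r, (\int[mu]_(t in D) (t ^+ r)%:E = (m r)%:E)%E.
Proof.
have [U [UU Uoo]] := ultraFilterLemma (F := \oo) _.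
have UP : ProperFilter U by exact: ultra_proper.
have momU r : (fun N => L N (fun t => t ^+ r)) @ U --> m r.
  by move=> B /(@L_cvg r); exact: Uoo.
pose H x := lim ((fun N => L N (step x)) @ U).
have HU x : (fun N => L N (step x)) @ U --> H x.
  by apply: (@ultra_bounded_cvg _ _ _ _ 0 1) => N; exact: functional_step_bounds.
have sumU K (c x : nat -> R) :
    (fun N => \sum_(i < K) c i * L N (step (x i))) @ U --> \sum_(i < K) c i * H (x i).
  by apply: cvg_sumr => i _; apply: cvgM; [exact: cvg_cst | exact: HU].
have H_le x a : (forall N, L N (step x) <= a) -> H x <= a.
  by move=> h; apply: (cvgr_to_le (HU x)); exact: nearW.
have H_ge x a : (forall N, a <= L N (step x)) -> a <= H x.
  by move=> h; apply: (cvgr_to_ge (HU x)); exact: nearW.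
have H1 x : H x <= 1 by apply: H_le => N; have /andP[] := functional_step_bounds N x.
have H0 x : 0 <= H x by apply: H_ge => N; have /andP[] := functional_step_bounds N x.
have H_anti x y : x <= y -> H y <= H x.
  move=> xy; apply: (ler_cvg_to (HU y) (HU x)); apply: nearW => N; apply: L_mono => t _.
  rewrite /step; case: (ltP y t) => [yt|]; last by [].
  by rewrite (le_lt_trans xy yt).
have H_neg x : x < 0 -> H x = 1.
  move=> x0; apply/eqP; rewrite eq_le H1 /=; apply: H_ge => N; rewrite -(L_1 N).
  by apply: L_mono => t t0; rewrite /step (lt_le_trans x0 t0).
have lower r K (c x : nat -> R) : (forall i, 0 <= c i) ->
    (forall t, 0 <= t -> \sum_(i < K) c i * step (x i) t <= t ^+ r) ->
    \sum_(i < K) c i * H (x i) <= m r.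
  move=> c0 h; apply: (ler_cvg_to (sumU K c x) (momU r)); apply: nearW => N.
  have := functional_sum N K c x (fun=> 0); rewrite functional_0 addr0 => <-.
  by apply: L_mono => t /h; rewrite addr0.
have upper r K (c x : nat -> R) a : (forall i, 0 <= c i) ->
    (forall t, 0 <= t -> t ^+ r <= \sum_(i < K) c i * step (x i) t + a * t ^+ r.+1) ->
    m r <= \sum_(i < K) c i * H (x i) + a * m r.+1.
  move=> c0 h.
  have hU : (fun N => \sum_(i < K) c i * L N (step (x i)) + a * L N (fun t => t ^+ r.+1)) @ U -->
      \sum_(i < K) c i * H (x i) + a * m r.+1.
    apply: cvgD; first exact: sumU.
    by apply: cvgM; [exact: cvg_cst | exact: momU].
  apply: (ler_cvg_to (momU r) hU); apply: nearW => N.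
  have E : a * L N (fun t => t ^+ r.+1) = L N (fun t => a * t ^+ r.+1).
    rewrite -[LHS]addr0 -(functional_0 N) -L_lin.
    by congr (L N _); apply/funext => t; rewrite addr0.
  by rewrite E -functional_sum; exact: L_mono.
(* The empty staircase lies below [t]. *)
have m10 : 0 <= m 1.
  have := lower 1%N 0%N (fun=> 0) (fun=> 0); rewrite !big_ord0; apply => // t t0.
  by rewrite big_ord0.
(* The staircase with the single jump [x * step x] lies below [t]. *)
have markov x : 0 < x -> H x <= m 1 / x.
  move=> x0; have := lower 1%N 1%N (fun=> x) (fun=> x).
  rewrite big_ord1 mulrC -ler_pdivlMr //; apply=> [_|t t0]; first exact: ltW.
  rewrite big_ord1 expr1 /step; case: (ltP x t) => [/ltW|]; first by rewrite mulr1.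
  by rewrite mulr0.
(* [H] may fail to be right-continuous; as it is antitone, this supremum is its right limit. *)
pose G x := sup [set H y | y in `]x, +oo[].
have G_sup x : has_sup [set H y | y in `]x, +oo[].
  split; first by exists (H (x + 1)), (x + 1) => //=; rewrite in_itv /= andbT ltrDl.
  by exists 1 => _ [y _ <-].
have HG x y : x < y -> H y <= G x.
  by move=> xy; apply: (sup_upper_bound (G_sup x)); exists y => //=; rewrite in_itv /= andbT.
have GH x a : (forall y, x < y -> H y <= a) -> G x <= a.
  move=> h; apply: ge_sup; first by case: (G_sup x).
  by move=> _ [y + <-]; rewrite /= in_itv /= andbT; exact: h.
have G_anti x y : x <= y -> G y <= G x.
  by move=> xy; apply: GH => z yz; apply: HG; exact: le_lt_trans yz.
have G1 x : G x <= 1 by apply: GH.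
have G0 x : 0 <= G x by apply: le_trans (HG x (x + 1) _); rewrite ?ltrDl.
have G_neg x : x < 0 -> G x = 1.
  move=> x0; apply/eqP; rewrite eq_le G1 /= -(H_neg (x / 2)); last by lra.
  by apply: HG; lra.
pose F x := 1 - G x.
have F_nd : nondecreasing F by move=> x y xy; rewrite lerD2l lerN2 G_anti.
have F_rc : right_continuous F.
  move=> x; apply: cvgB; first exact: cvg_cst.
  apply/cvgrPdist_le => e e0.
  have [_ [z + <-] hz] := sup_adherent e0 (G_sup x); rewrite /= in_itv /= andbT => xz.
  near=> y; have xy : x < y by near: y; exact: nbhs_right_gt.
  have yz : y < z by near: y; exact: nbhs_right_lt.
  have GyGx : G y <= G x by exact/G_anti/ltW.
  have GxGy : G x - e < G y by exact: lt_le_trans hz (HG _ _ yz).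
  by rewrite ger0_norm ?subr_ge0 //; lra.
have F_Ny : F @ -oo%R --> (0 : R).
  apply/cvgrPdist_le => e e0; near=> x.
  have x0 : x < 0 by near: x; exact: nbhs_ninfty_lt.
  by rewrite /F G_neg // subrr subr0 normr0 ltW.
have F_y : F @ +oo%R --> (1 : R).
  apply/cvgrPdist_le => e e0; near=> x.
  have x0 : 0 < x by near: x; apply: nbhs_pinfty_gt; exact: num_real.
  have xe : m 1 / e < x by near: x; apply: nbhs_pinfty_gt; exact: num_real.
  rewrite /F opprB addrC subrK ger0_norm //.
  apply: (@le_trans _ _ (m 1 / x)).
    apply: GH => y xy; apply: le_trans (markov _ (lt_trans x0 xy)) _.
    by rewrite ler_wpM2l // lef_pV2 ?posrE ?ltW // (lt_trans x0 xy).
  by rewrite ler_pdivrMr // mulrC -ler_pdivrMr // ltW.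
have [mu muE] := probability_of_cdf F_nd F_rc F_Ny F_y.
have muG x : mu `]x, +oo[ = (G x)%:E.
  rewrite -setCitvl probability_setC // muE -EFinB; congr (_%:E).
  by rewrite /F opprB addrC subrK.
have mu0 : mu `]-oo, 0[ = 0%E.
  (* [muE] concerns closed half-lines, so the open one is exhausted by those ending at
     [- 1 / (n + 1)], which are null because [G] is 1 on the negatives. *)
  have sub : `]-oo, 0[%classic `<=` \bigcup_n (`]-oo, (- (n.+1%:R)^-1)%R]%classic : set R).
    move=> t; rewrite /= in_itv /= => t0; exists (Num.truncn (- t)^-1) => //=.
    rewrite in_itv /= lerNr.
    have tV : 0 < (- t)^-1 by rewrite invr_gt0 oppr_gt0.
    have /andP[_ h] := truncn_itv (ltW tV).
    by rewrite -[leRHS]invrK lef_pV2 ?posrE ?ltr0n // ltW.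
  have neg : mu.-negligible (\bigcup_n (`]-oo, (- (n.+1%:R)^-1)%R]%classic : set R)).
    apply: negligible_bigcup => n; apply/negligibleP => //.
    by apply: (etrans (muE _)); rewrite /F G_neg ?subrr // oppr_lt0 invr_gt0 ltr0n.
  by apply/negligibleP => //; exact: negligibleS neg.
(* The staircases start from [0 ^+ r = 0], so [r = 0] is treated apart, as the total mass. *)
exists mu; split => // r; case: (posnP r) => [->|r0].
  have -> : m 0%N = 1.
    have h := @L_cvg 0%N; have E : (fun N => L N (fun t => t ^+ 0)) = (fun=> 1).
      by apply/funext => N; rewrite -[RHS](L_1 N); congr (L N _); apply/funext => t; rewrite expr0.
    rewrite E in h; apply: (@cvg_unique _ (@Rhausdorff R) _ _ _ _ h).
    exact: cvg_cst.
  under eq_integral do rewrite expr0.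
  rewrite integral_cst // mul1e -(probability_setT mu).
  by rewrite -[RHS](probability_setIr_ge0 mu0) // setTI.
apply: (moments_of_tail_bounds (H := H)) => //.
- by move=> x; rewrite muG lee_fin; apply: GH => y /ltW; exact: H_anti.
- by move=> x y xy; rewrite muG lee_fin HG.
- by move=> K c x; exact: lower.
- by move=> K c x a; exact: upper.
Unshelve. all: by end_near. Qed.

End MomentExistence.

(** * Spectral form of the moments *)

(** The matrix is Hermitian, hence unitarily diagonalizable by some [P]; its diagonal form is the
    Gram matrix of [P *m V], so the diagonal entries are sums of squared moduli. *)
Lemma gram_spectral (C : numClosedFieldType) n (V : 'M[C]_n) :
  exists d : 'I_n -> C, (forall j, 0 <= d j) /\
    forall r, \tr ((V *m (map_mx (@Num.conj C) V)^T) ^+ r) = \sum_j d j ^+ r.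
Proof.
rewrite map_trmx; pose adj (A : 'M[C]_n) := map_mx (@Num.conj C) A^T.
have adjM A B : adj (A *m B) = adj B *m adj A by rewrite /adj trmx_mul map_mxM.
have adjK A : adj (adj A) = A.
  by apply/matrixP => i j; rewrite !mxE /= conjCK.
set X := V *m _; have XV : X = V *m adj V by [].
have adjX : adj X = X by rewrite XV adjM adjK.
have Xn : X \is normalmx by apply/normalmxP; change (X *m adj X = adj X *m X); rewrite adjX.
pose P := spectralmx X; pose sp := spectral_diag X.
have XE : X = invmx P *m diag_mx sp *m P by apply/orthomx_spectralP.
have Pu : P \in unitmx by exact: spectral_unit.
have Pinv : invmx P = adj P by apply: invmx_unitary; exact: spectral_unitarymx.
have dE : diag_mx sp = (P *m V) *m adj (P *m V).
  rewrite adjM -Pinv mulmxA -[X in X *m _]mulmxA -XV XE.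
  by rewrite !mulmxA mulmxV // mul1mx mulmxK.
exists (fun j => sp 0 j); split.
  move=> j; have -> : sp 0 j = (diag_mx sp) j j by rewrite mxE eqxx mulr1n.
  rewrite dE mxE sumr_ge0 // => l _; rewrite !mxE.
  exact: mul_conjC_ge0.
move=> r; have -> : X ^+ r = invmx P *m diag_mx sp ^+ r *m P.
  elim: r => [|r IH]; first by rewrite !expr0 mulmx1 mulVmx.
  rewrite !exprSr IH.
  change (invmx P *m diag_mx sp ^+ r *m P *m X = invmx P *m (diag_mx sp ^+ r *m diag_mx sp) *m P).
  by rewrite [X in _ *m X = _]XE !mulmxA mulmxK.
rewrite mxtrace_mulC mulmxA mulmxV // mul1mx.
have -> : diag_mx sp ^+ r = diag_mx (map_mx (fun x => x ^+ r) sp).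
  elim: r => [|r IH].
    by apply/matrixP => i j; rewrite !mxE expr0.
  rewrite exprS IH; change (diag_mx sp *m diag_mx (map_mx (fun x => x ^+ r) sp) =
    diag_mx (map_mx (fun x => x ^+ r.+1) sp)).
  rewrite mulmx_diag; by congr diag_mx; apply/rowP => j; rewrite !mxE exprS.
by rewrite mxtrace_diag; apply: eq_bigr => j _; rewrite mxE.
Qed.

(** The [lam j] are the eigenvalues, real because a nonnegative complex number is real. *)
Lemma Xmx_spectral (R : realType) (k : nat -> nat) N (th : nat -> R) : exists lam : 'I_N -> R,
  (forall j, 0 <= lam j) /\ forall r, trX k N r th = N%:R^-1 * \sum_j lam j ^+ r.
Proof.
have [d [d0 dtr]] := gram_spectral (Vmx k N th).
exists (fun j => complex.Re (d j)).
have dE j : d j = real_complex R (complex.Re (d j)).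
  by have := ger0_Im (d0 j); case: (d j) => a b /= ->.
split=> [j|r]; first by have := d0 j; rewrite {1}dE ler0c.
rewrite /trX; have -> : \tr (Xmx k N th ^+ r) = \sum_j d j ^+ r by exact: dtr.
have -> : (N%:R : R[i])^-1 * \sum_j d j ^+ r =
    real_complex R (N%:R^-1 * \sum_j complex.Re (d j) ^+ r).
  rewrite rmorphM fmorphV rmorph_nat rmorph_sum; congr (_ * _).
  by apply: eq_bigr => j _; rewrite rmorphXn; congr (_ ^+ r); exact: dE.
by [].
Qed.

(** * Finitely supported laws from grids *)

Section GridFunctional.
Context {R : realType}.

Lemma iter_expect_mono (E : (R -> R) -> R) n (f g : (nat -> R) -> R) :
  (forall u v : R -> R, (forall x, u x <= v x) -> E u <= E v) ->
  (forall th, f th <= g th) -> iter_expect E n f <= iter_expect E n g.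
Proof. by move=> hE; elim: n f g => [|n IH] f g fg //=; apply: hE => x; exact: IH. Qed.

Lemma iter_expect_lin (E : (R -> R) -> R) n a (f g : (nat -> R) -> R) :
  (forall (u v : R -> R), E (fun x => a * u x + v x) = a * E u + E v) ->
  iter_expect E n (fun th => a * f th + g th) = a * iter_expect E n f + iter_expect E n g.
Proof.
move=> hE; elim: n f g => [|n IH] f g //=; rewrite -hE; congr E; apply/funext => x.
exact: IH.
Qed.

Lemma iter_expect_cst (E : (R -> R) -> R) n (a : R) :
  E (fun=> a) = a -> iter_expect E n (fun=> a) = a.
Proof.
move=> hE; elim: n => [|n IH] //=; rewrite -[RHS]hE; congr E; exact/funext.
Qed.

(* Replacing the uniform law on [0, 1] by a grid fine enough to integrate exactly the
   trigonometric polynomials in play makes the mean spectral measure finitely supported. *)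
Lemma mean_spectral_functional (k : nat -> nat) N :
  (forall p q : nat, (0 < p)%N -> (p < q)%N -> (k p < k q)%N) -> (0 < N)%N ->
  exists L : (R -> R) -> R,
  [/\ forall f g, (forall t, 0 <= t -> f t <= g t) -> L f <= L g,
      forall a f g, L (fun t => a * f t + g t) = a * L f + L g,
      L (fun=> 1) = 1 &
      forall r, (0 < r <= N)%N -> L (fun t => t ^+ r) = mix_moment k r N].
Proof.
move=> k_incr N0; have [lam lamP] := boolp.choice (@Xmx_spectral R k N).
have NR0 : (N%:R : R) != 0 by rewrite pnatr_eq0 -lt0n.
(* For [r <= N], [trX_freq_bound] keeps all frequencies below this grid size. *)
pose M := (N * k N).+1; pose E := @grid_mean R M.
(* The eigenvalues are chosen for each [th] without any measurability; the finite mean [E] is linear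
   on all functions. *)
exists (fun f => iter_expect E N (fun th => N%:R^-1 * \sum_j f (lam th j))).
split => [f g fg|a f g||r /andP[r0 rN]].
- apply: iter_expect_mono => [u v uv|th].
    by rewrite /E /grid_mean ler_wpM2l ?invr_ge0 // ler_sum.
  by rewrite ler_wpM2l ?invr_ge0 // ler_sum // => j _; apply: fg; case: (lamP th).
- rewrite -iter_expect_lin => [|u v].
    congr iter_expect; apply/funext => th.
    by rewrite big_split /= mulrDr -mulr_sumr mulrCA.
  by rewrite /E /grid_mean big_split /= mulrDr -mulr_sumr mulrCA.
- rewrite -[RHS](@iter_expect_cst E N 1); last first.
    by rewrite /E /grid_mean sumr_const card_ord mulVf ?pnatr_eq0.
  congr iter_expect; apply/funext => th.
  by rewrite sumr_const card_ord mulVf.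
transitivity (iter_expect E N (trX k N r)).
  by congr iter_expect; apply/funext => th; case: (lamP th) => _ ->.
apply: (@iter_expect_trX R E (fun c => `|c| < M)%N) => // [I w phi c cM|p q j].
  exact: grid_mean_sum_cos.
rewrite ltnS; apply: leq_trans (trX_freq_bound _ _ _ k_incr) _.
by rewrite leq_mul2r rN orbT.
Qed.

End GridFunctional.

(** * Convergence of the moments and conclusion *)

Lemma cvg_moment_seq (R : realType) (k : nat -> nat) r :
  (forall rho : {set {set 'I_r}},
     (0 < r)%N -> finset.partition rho [set: 'I_r] -> cvgn (S_ratio R k rho)) ->
  (moment_seq R k r @ \oo --> (if r is 0 then 1 : R else
    \sum_(rho : {set {set 'I_r}} | finset.partition rho [set: 'I_r]) Klim R k rho))%classic.
Proof.
case: r => [|r] hK.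
  apply: (@cvg_trans _ ((fun _ : nat => 1 : R) @ \oo)%classic); last exact: cvg_cst.
  (* For [r = 0] the value 1 holds from [N = 1] on, the empty matrix having trace 0. *)
  apply: near_eq_cvg; near=> N.
  by rewrite moment_seq0 //; near: N; exact: nbhs_infty_gt.
have -> : moment_seq R k r.+1 = mix_moment k r.+1 by apply/funext => N; rewrite moment_seqE.
by apply: cvg_mix_moment => rho; exact: hK.
Unshelve. all: by end_near. Qed.

Theorem mainTheorem17 (R : realType) (k : nat -> nat)
  (k_pos : forall p : nat, (0 < p)%N -> (0 < k p)%N)
  (k_incr : forall p q : nat, (0 < p)%N -> (p < q)%N -> (k p < k q)%N)
  (hK : forall (r : nat) (rho : {set {set 'I_r}}),
      (0 < r)%N -> finset.partition rho [set: 'I_r] -> cvgn (S_ratio R k rho)) :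
  (forall (r : nat) (rho : {set {set 'I_r}}),
      (0 < r)%N -> finset.partition rho [set: 'I_r] ->
      0 <= Klim R k rho <= 1)
  /\ (forall r : nat, cvgn (moment_seq R k r))
  /\ (forall r : nat, (0 < r)%N ->
      limn (moment_seq R k r) =
      \sum_(rho : {set {set 'I_r}} | finset.partition rho [set: 'I_r]) Klim R k rho)
  /\ (exists mu : probability R R,
      mu (`]-oo, 0[)%classic = 0%E
      /\ (forall r : nat,
          (\int[mu]_(t in (`[0%R, +oo[)%classic) (t ^+ r)%:E)%E = (limn (moment_seq R k r))%:E)
      /\ (forall nu : probability R R,
          nu (`]-oo, 0[)%classic = 0%E ->
          (forall r : nat,
            (\int[nu]_(t in (`[0%R, +oo[)%classic) (t ^+ r)%:E)%E = (limn (moment_seq R k r))%:E) ->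
          forall A : set R, measurable A -> nu A = mu A)).
Proof.
have Kb r (rho : {set {set 'I_r}}) : (0 < r)%N -> finset.partition rho [set: 'I_r] ->
    0 <= Klim R k rho <= 1 by move=> r0 prho; apply: Klim_bounds => //; exact: hK.
have mcvg r := @cvg_moment_seq R k r (@hK r).
pose m r := limn (moment_seq R k r).
have cvgm r : cvgn (moment_seq R k r) by apply/cvg_ex; eexists; exact: mcvg.
have mS r : (0 < r)%N -> m r =
    \sum_(rho : {set {set 'I_r}} | finset.partition rho [set: 'I_r]) Klim R k rho.
  by move=> r0; rewrite /m (cvg_lim _ (mcvg r)) //; case: r r0.
(* As every [Klim] is at most 1, [m r] is at most the number of partitions, to which the Dobinski
   bound applies. *)
have growth s : 0 <= s -> ((fun r => s ^+ r * m r / r`!%:R) @ \oo --> (0 : R))%classic.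
  move=> s0; apply: (@squeeze_cvgr _ _ _ _ (fun=> 0)); last 2 first.
  - exact: cvg_cst.
  - exact: cvg_dobinski_bound s0.
  near=> r; have r0 : (0 < r)%N by near: r; exact: nbhs_infty_gt.
  rewrite (mS r r0) mulrAC; apply/andP; split.
    rewrite mulr_ge0 ?divr_ge0 ?exprn_ge0 // sumr_ge0 // => rho prho.
    by have /andP[] := Kb r rho r0 prho.
  rewrite ler_wpM2l ?divr_ge0 ?exprn_ge0 // (le_trans _ (card_partitions_le r)) //.
  by apply: ler_sum => rho prho; have /andP[] := Kb r rho r0 prho.
(* Dimension [N + 1] avoids the empty matrix; a given moment is exact once [r <= N + 1]. *)
have [L LP] := boolp.choice (fun N => @mean_spectral_functional R k N.+1 k_incr isT).
have Lcvg r : ((fun N => L N (fun t => t ^+ r)) @ \oo --> m r)%classic.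
  have : ((fun N => moment_seq R k r N.+1) @ \oo --> m r)%classic.
    by rewrite (cvg_shiftS (moment_seq R k r)); exact: cvgm.
  apply: cvg_trans; apply: near_eq_cvg; near=> N; have [_ _ L1 Lr] := LP N.
  have [->|r0] := posnP r.
    by rewrite moment_seq0 // (_ : (fun t => t ^+ 0) = (fun=> 1)).
  rewrite moment_seqE // Lr // r0 /= ltnW // ltnS.
  by near: N; exact: nbhs_infty_ge.
have [] := @moment_existence R L m _ _ _ Lcvg.
- by move=> N; case: (LP N).
- by move=> N; case: (LP N).
- by move=> N; case: (LP N).
move=> mu [mu0 mum]; split; first exact: Kb.
split; first exact: cvgm.
split; first exact: mS.
exists mu; split; first exact: mu0.
split; first exact: mum.
move=> nu nu0 num A mA.
exact: (moment_determinacy nu0 mu0 num mum growth mA).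
Unshelve. all: by end_near. Qed.
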